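(* Let $T>0$ and let $u\in C([0,T]; \mathcal{Z}_{4,2})$ be a solution of the initial-value problem $$ \begin{cases} u_{t}+\mathcal{H}\partial_{x}^{2}u+u_{xyy}+uu_{x}=0, & (x,y)\in\mathbb{R}^2,\ t>0,\\ u(x,y,0)=\phi(x,y). \end{cases} $$ If there exist two different times $t_1, t_2 \in [0,T]$ such that $u(t_j)\in \mathcal{Z}_{5,5/2}$ for $j=1,2$, then $$ \hat{u}(0,\eta,t)=0 $$ for all $\eta\in\mathbb{R}$ and all $t\in[0,T]$.
   Context: The function $u=u(x,y,t)$ is real-valued. $\mathcal{H}$ is the Hilbert transform in the $x$ variable, $\mathcal{H}u(x,y,t)=\mathrm{p.v.}\frac{1}{\pi}\int_{\mathbb{R}}\frac{u(z,y,t)}{x-z}\,dz$ (Fourier multiplier $-i\,\mathrm{sgn}(\xi)$). $\hat u(\xi,\eta,t)=\int_{\mathbb{R}^2}e^{-i(x\xi+y\eta)}u(x,y,t)\,dx\,dy$ is the Fourier transform in the space variables. $\mathcal{Z}_{s,r}:=H^s(\mathbb{R}^2)\cap L^2((1+x^2+y^2)^{r}\,dx\,dy)$, with squared norm the sum of the squared norms of the two spaces. Solution means that the equation holds in the sense of distributions (with $uu_x=\frac12\partial_x(u^2)$), equivalently that the corresponding Duhamel integral equation holds. *)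

(* Defs.v *)
From HB Require Import structures.
From mathcomp Require Import all_boot all_order all_algebra.
From mathcomp Require Import all_classical all_reals all_analysis.
From mathcomp Require Import complex.

Set Implicit Arguments.
Unset Strict Implicit.
Unset Printing Implicit Defensive.

Import Order.TTheory GRing.Theory Num.Theory.
Import numFieldNormedType.Exports.

Local Open Scope classical_set_scope.
Local Open Scope ring_scope.
Local Open Scope complex_scope.

(* R^2 with its Borel sigma-algebra. *)
Notation plane R := (measurableTypeR R * measurableTypeR R)%type.

Notation leb1 := lebesgue_measure.
Notation leb2 := (lebesgue_measure \x lebesgue_measure)%E.

Section Spaces.
Context {R : realType}.
Implicit Types (f : plane R -> R) (g : plane R -> R[i]) (s r : R).

(* int e^{-i (x xi + y eta)} f(x, y) dx dy; meaningful for f in L^1. *)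
Definition fourier f : plane R -> R[i] := fun q =>
  (\int[leb2]_(p in setT) (f p * cos (p.1 * q.1 + p.2 * q.2)))
  +i* (- \int[leb2]_(p in setT) (f p * sin (p.1 * q.1 + p.2 * q.2))).

Definition normsq (z : R[i]) : R := complex.Re z ^+ 2 + complex.Im z ^+ 2.

Definition truncate (n : nat) f : plane R -> R := fun p =>
  f p * \1_[set q : plane R | `|q.1| <= n%:R /\ `|q.2| <= n%:R] p.

(* The Fourier(-Plancherel) transform on L^2: the limit in L^2 of the
   transforms of the truncations of f, which are in L^1.  It determines g up
   to a null set. *)
Definition is_fourierL2 f g : Prop :=
  [/\ measurable_fun setT (fun q => complex.Re (g q)),
      measurable_fun setT (fun q => complex.Im (g q)) &
      (fun n : nat =>
        \int[leb2]_(q in setT) (normsq (fourier (truncate n f) q - g q))%:E)%E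
      @ \oo --> 0%E].

Definition bracket (p : plane R) : R := 1 + p.1 ^+ 2 + p.2 ^+ 2.

(* Squared norm of f in L^2((1 + x^2 + y^2)^r dx dy). *)
Definition weighted_normsq r f : \bar R :=
  (\int[leb2]_(p in setT) (bracket p `^ r * f p ^+ 2)%:E)%E.

(* Squared norm of f in H^s.  All L^2 transforms g of f coincide almost
   everywhere, so this infimum ranges over a single value if f is in L^2 (and
   is +oo if f has no L^2 transform). *)
Definition sobolev_normsq s f : \bar R :=
  ereal_inf [set (\int[leb2]_(q in setT) (bracket q `^ s * normsq (g q))%:E)%E
            | g in is_fourierL2 f].

(* H^s for s >= 0 (for s < 0 its elements need not be functions). *)
Definition in_sobolev s f : Prop :=
  [/\ measurable_fun setT f,
      (\int[leb2]_(p in setT) (f p ^+ 2)%:E < +oo)%E &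
      (sobolev_normsq s f < +oo)%E].

Definition in_weighted r f : Prop :=
  measurable_fun setT f /\ (weighted_normsq r f < +oo)%E.

Definition in_Z s r f : Prop := in_sobolev s f /\ in_weighted r f.

Definition Z_normsq s r f : \bar R :=
  (sobolev_normsq s f + weighted_normsq r f)%E.

(* u is in C([0, T]; Z_{s,r}); u t stands for the class of u(., ., t). *)
Definition continuous_in_Z s r (T : R) (u : R -> plane R -> R) : Prop :=
  (forall t, t \in `[0, T] -> in_Z s r (u t)) /\
  (forall t0, t0 \in `[0, T] ->
     (fun t => Z_normsq s r (fun p => u t p - u t0 p))
       @ within `[0, T] (nbhs t0) --> 0%E).

End Spaces.

Section Equation.
Context {R : realType}.

(* p.v. (1/pi) int f(z, y) / (x - z) dz *)
Definition hilbert_x (f : R * R -> R) : R * R -> R := fun p =>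
  pi^-1 * lim ((fun e : R => \int[leb1]_(z in [set z : measurableTypeR R |
                                                e < `|p.1 - z|])
                               (f (z, p.2) / (p.1 - z))) @ 0^'+).

(* Functions on R^3 take their arguments as ((x, y), t). *)
Definition d_x (psi : R * R * R -> R) : R * R * R -> R :=
  fun w => 'D_((1, 0, 0) : R * R * R) psi w.
Definition d_y (psi : R * R * R -> R) : R * R * R -> R :=
  fun w => 'D_((0, 1, 0) : R * R * R) psi w.
Definition d_t (psi : R * R * R -> R) : R * R * R -> R :=
  fun w => 'D_((0, 0, 1) : R * R * R) psi w.

Fixpoint iter_derive (vs : seq (R * R * R)) (psi : R * R * R -> R) :
    R * R * R -> R :=
  if vs is v :: vs' then fun w => 'D_v (iter_derive vs' psi) w else psi.

(* C^oo: all iterated directional derivatives exist and are continuous. *)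
Definition smooth (psi : R * R * R -> R) : Prop :=
  forall vs : seq (R * R * R),
    continuous (iter_derive vs psi) /\
    forall v w, derivable (iter_derive vs psi) w v.

Definition test_function (T : R) (psi : R * R * R -> R) : Prop :=
  [/\ smooth psi,
      compact (closure [set w | psi w != 0]) &
      closure [set w | psi w != 0] `<=` [set w | 0 < w.2 < T]].

(* u_t + H u_xx + u_xyy + (u^2/2)_x = 0 in the sense of distributions on
   R^2 x (0, T).  The kernel of H is odd, so that
   <H u_xx, psi> = - <u, H psi_xx>, and each of the other three terms also
   carries an odd number of derivatives; the identity below is the equation
   tested against - psi. *)
Definition distributional_solution (T : R) (u : R -> R * R -> R) : Prop :=
  forall psi, test_function T psi ->
    \int[leb1]_(t in `]0, T[)
      (\int[leb2]_(p in setT)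
         (u t p * (d_t psi (p, t)
                   + hilbert_x (fun q => d_x (d_x psi) (q, t)) p
                   + d_x (d_y (d_y psi)) (p, t))
          + 2^-1 * u t p ^+ 2 * d_x psi (p, t))) = 0.

End Equation.

(* Main.v *)
(* Pair the equation with W(x) g(y), W and g smooth with compact support: in time,
   the derivative of <u, W g> is
     <u, H W'' g> + <u, W' g''> + 1/2 <u^2, W' g>.
   For the dilations W = b(x/n) of a bump b with b(0) <> 0, the right-hand side
   tends to 0, so m(t) = int u(x, y, t) g(y) dx dy does not depend on t.  For
   W = n^2 w(x/n), with w a bump supported in [1, 2], W' tends to 0 pointwise
   with linear growth, whereas H W'' = (H w'')(x/n) tends to the constant
   H w''(0), which is nonzero since it is -(2/pi) int w(s) / s^3 ds.  On the other
   hand, Cauchy-Schwarz on n <= x <= 2 n with the weight (1 + x^2 + y^2)^(5/2)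
   gives <u(t_j), W g> -> 0 for j = 1, 2.  Integrating from t_1 to t_2 yields
   (t_2 - t_1) m = 0.  Hence m = 0 for every g, and g(y) -> exp(-i eta y) gives
   the conclusion. *)

Require Import Defs.
From HB Require Import structures.
From mathcomp Require Import all_boot all_order all_algebra.
From mathcomp Require Import all_classical all_reals all_analysis.
From mathcomp Require Import measurable_realfun complex.
From mathcomp Require Import ring lra.

Set Implicit Arguments.
Unset Strict Implicit.
Unset Printing Implicit Defensive.

Import Order.TTheory GRing.Theory Num.Theory.
Import numFieldNormedType.Exports.

Local Open Scope classical_set_scope.
Local Open Scope ring_scope.

(** * Smooth functions *)

Section Smooth.
Context {R : realType}.

(** The weight 5/2 is critical for the dipole: n^2 from its amplitude, n^(1/2) from the length of
    its support and n^(-5/2) from the weight multiply to 1. Cauchy-Schwarz alone thus gives only a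
    bounded pairing; it tends to 0 because the weighted norm is taken over x >= n, the tail of a
    convergent integral. The weight 2, available at all times, legitimates the limits: it pairs with
    kernels of growth 1 + |x| that decay in y, and u^2 with densities up to (1 + x^2 + y^2)^2. The
    bump must be one-sided: H of an even function is odd and vanishes at 0, so a symmetric w would
    produce no constant. Support away from 0 also frees H w''(0) of any singularity. The equation is
    known only against test functions supported in the open slab 0 < t < T, whereas increments up to
    t = 0 and t = T are wanted; continuity in time closes this gap. Cauchy-Schwarz appears
    throughout as a b <= a^2 / d + d b^2 with d free, so no square root of an integral occurs. *)

Fixpoint Cn {V : normedModType R} (n : nat) (f : V -> R) : Prop :=
  if n is m.+1
  then (forall x, differentiable f x) /\ forall v, Cn m (fun x => 'D_v f x)
  else True.

(** Full differentiability at every order lets products and compositions go through by induction,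
    and it implies the directional form [smooth] required of test functions. Any normed space is
    allowed, so that one notion serves on the line and on R^3. *)
Definition Cinf {V : normedModType R} (f : V -> R) := forall n, Cn n f.

Section Generic.
Context {V : normedModType R}.
Implicit Types f g : V -> R.

Lemma CnW n f : Cn n.+1 f -> Cn n f.
Proof.
elim: n f => [//|n IH] f [df Df]; split => // v.
by apply: IH; exact: Df.
Qed.

Lemma Cn_ext n f g : f =1 g -> Cn n f -> Cn n g.
Proof. by move=> /funext ->. Qed.

Lemma CnD n f g : Cn n f -> Cn n g -> Cn n (fun x => f x + g x).
Proof.
elim: n f g => [//|n IH] f g [df Df] [dg Dg]; split.
  by move=> x; apply: differentiableD.
move=> v; apply: Cn_ext (IH _ _ (Df v) (Dg v)) => x.
by rewrite -deriveD//; apply: diff_derivable.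
Qed.

Lemma Cn_cst n (c : R) : Cn n (fun _ : V => c).
Proof.
elim: n c => [//|n IH] c; split => [x|v]; first exact: differentiable_cst.
by apply: Cn_ext (IH 0) => x; rewrite derive_cst.
Qed.

Lemma CnM n f g : Cn n f -> Cn n g -> Cn n (fun x => f x * g x).
Proof.
elim: n f g => [//|n IH] f g Cf Cg.
have [Cf' Cg'] := (CnW Cf, CnW Cg); case: Cf Cg => df Df [dg Dg]; split.
  by move=> x; apply: differentiableM.
move=> v; apply: Cn_ext (CnD (IH _ _ Cf' (Dg v)) (IH _ _ Cg' (Df v))) => x.
by rewrite (@deriveM _ _ f g)//; apply: diff_derivable.
Qed.

Lemma CinfM f g : Cinf f -> Cinf g -> Cinf (fun x => f x * g x).
Proof. by move=> Cf Cg n; apply: CnM. Qed.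

Lemma Cinf_cst (c : R) : Cinf (fun _ : V => c).
Proof. by move=> n; apply: Cn_cst. Qed.

Lemma Cinf_differentiable f x : Cinf f -> differentiable f x.
Proof. by move=> /(_ 1%N)[]. Qed.

Lemma Cinf_continuous f : Cinf f -> continuous f.
Proof. by move=> Cf x; apply/differentiable_continuous/Cinf_differentiable. Qed.

Lemma Cinf_derive f v : Cinf f -> Cinf ('D_v f).
Proof. by move=> Cf n; have [_] := Cf n.+1; apply. Qed.

End Generic.

(** The differential of [h] is the same map [L] at every point, so the derivative of [f \o h] along
    [v] is the derivative of [f] along [L v], composed with [h]. It has the same form again, and the
    induction needs no higher chain rule. *)
Lemma Cinf_comp_affine (V W : normedModType R) (f : W -> R) (h L : V -> W) :
  (forall x, differentiable h x) -> (forall x, 'd h x = L :> (V -> W)) ->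
  Cinf f -> Cinf (f \o h).
Proof.
move=> dh dhL Cf n; elim: n f Cf => [//|n IH] f Cf; split => [x|v].
  by apply: differentiable_comp => //; exact: Cinf_differentiable.
apply: Cn_ext (IH _ (Cinf_derive (L v) Cf)) => x /=.
have dfh := Cinf_differentiable (h x) Cf.
rewrite !deriveE//; last exact: differentiable_comp.
rewrite -(dhL x) (diff_comp (dh x) dfh).
by [].
Qed.

Lemma Cinf_lincomb (f : R -> R) (a c : R) : Cinf f -> Cinf (fun x => f (a * x + c)).
Proof.
apply: (@Cinf_comp_affine _ _ f (fun x => a * x + c) (fun x => a * x)) => x.
  by apply: differentiableD => //; apply: differentiableM.
have h : is_diff x (fun x : R => a * x + c) (fun x => a * x).
  have -> : (fun x : R => a * x + c) = ( *:%R a) + cst c by [].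
  by apply: (is_diff_eq (is_diffD _ _)); apply/funext => y /=; rewrite addr0.
exact: diff_val.
Qed.

Lemma Cinf_is_derive (f : R -> R) (x : R) : Cinf f -> is_derive x (1 : R) f ('D_(1 : R) f x).
Proof.
by move=> Cf; apply: derivableP; apply: diff_derivable; exact: Cinf_differentiable.
Qed.

Lemma CinfS (f g : R -> R) :
  (forall x : R, is_derive x (1 : R) f (g x)) -> Cinf g -> Cinf f.
Proof.
move=> df Cg [//|n]; have diff_f x : differentiable f x.
  by apply/derivable1_diffP; exact: ex_derive.
split => // v; apply: Cn_ext (CnM (Cn_cst n v) (Cg n)) => x.
have [_ <-] := df x; rewrite !deriveE//.
by rewrite -[in RHS](mulr1 v) linearZ.
Qed.

Lemma exprn_le_expR (s : R) n : 0 <= s -> s ^+ n.+1 <= n.+1`!%:R * expR s.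
Proof.
move=> s0; rewrite mulrC -ler_pdivrMr ?ltr0n ?fact_gt0//.
by apply: le_trans (expR_ge1Dxn n s0); rewrite lerDr.
Qed.

Lemma horner_expRN_bounded (p : {poly R}) :
  exists C : R, forall s, 0 <= s -> `|p.[s] * expR (- s)| <= C.
Proof.
exists (\sum_(i < size p) `|p`_i| * (i.+1`!%:R)) => s s0.
rewrite horner_coef mulr_suml (le_trans (ler_norm_sum _ _ _))// ler_sum// => i _.
rewrite -mulrA normrM ler_wpM2l// ger0_norm ?mulr_ge0 ?exprn_ge0 ?expR_ge0//.
rewrite expRN ler_pdivrMr ?expR_gt0//.
have e1 : 1 <= expR s by rewrite -expR0 ler_expR.
case: i => [[|i] /= _].
  by rewrite expr0 mul1r.
apply: (le_trans (exprn_le_expR _ s0)).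
by rewrite ler_wpM2r ?expR_ge0// ler_nat leq_fact.
Qed.

(* The family {p(1/x) exp(-1/x)} is stable under differentiation, which makes
   its members smooth across 0. *)
Definition expinv (p : {poly R}) (x : R) : R :=
  if 0 < x then p.[x^-1] * expR (- x^-1) else 0.

(** With y = 1/x, the chain rule turns p(y) exp(-y) into y^2 (p - p')(y) exp(-y). Only x = 0 needs
    an estimate. *)
Lemma is_derive_expinv (p : {poly R}) (x : R) :
  is_derive x (1 : R) (expinv p) (expinv ('X^2 * (p - p^`())) x).
Proof.
have [x0|x0|->] := ltgtP x 0.
- have -> : expinv ('X^2 * (p - p^`())) x = 0 by rewrite /expinv ltNge ltW.
  apply: (@near_eq_is_derive _ _ _ (cst 0)) => //; last first.
    near=> y; rewrite /expinv ltNge; have -> // : y <= 0.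
    by apply: ltW; near: y; exact: lt_nbhsl.
- have x0' : x != 0 by rewrite gt_eqF.
  pose f0 (y : R) : R := p.[y^-1] * expR (- y^-1).
  apply: (@near_eq_is_derive _ _ _ f0) => //.
    near=> y; rewrite /expinv /f0; have -> // : 0 < y.
    by near: y; exact: lt_nbhsr.
  have dV : is_derive x (1 : R) (fun x : R => x^-1) (- x ^- 2).
    by apply: is_derive_eq; [exact: is_deriveV|rewrite /GRing.scale /= mulr1].
  have d1 := is_derive1_comp (is_derive_poly p x^-1) dV.
  have dN : is_derive x (1 : R) (fun y : R => - y^-1) (- (- x ^- 2)) := is_deriveN dV.
  have d2 := @is_derive1_comp _ expR (fun y : R => - y^-1) x _ _ (is_derive_expR (- x^-1)) dN.
  have d12 := is_deriveM d1 d2.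
  have e12 : (horner p \o GRing.inv) * (expR \o (fun y : R => - y^-1)) = f0 by [].
  rewrite e12 in d12; apply: (is_derive_eq d12).
  rewrite /expinv x0 !hornerE /= /GRing.scale /= exprVn.
  ring.
- have -> : expinv ('X^2 * (p - p^`())) 0 = 0 by rewrite /expinv ltxx.
  (* For h > 0 the difference quotient p(1/h) exp(-1/h) / h is h times (X^2 p)(1/h) exp(-1/h), hence
     at most C h in absolute value; for h < 0 it is 0. *)
  have [C HC] := horner_expRN_bounded ('X^2 * p).
  suff c0 : h^-1 *: (expinv p (h + 0) - expinv p 0) @[h --> (0:R)^'] --> (0 : R).
    have e : (fun h : R => h^-1 *: (expinv p (h *: 1 + 0) - expinv p 0)) = (fun h : R => h^-1 *: (expinv p (h + 0) - expinv p 0)).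
      by apply/funext => h; rewrite /GRing.scale/= mulr1.
    apply: DeriveDef; first by apply/cvg_ex; exists 0; rewrite /= e.
    by rewrite /derive e; apply/cvg_lim.
  have c0 : C * `|h| @[h --> (0:R)^'] --> (0 : R).
    suff : C * `|h| @[h --> (0:R)^'] --> C * `|0 : R| by rewrite normr0 mulr0.
    by apply: cvg_within_filter; apply: cvgMr; apply: cvg_norm; exact: cvg_id.
  apply: norm_cvg0; apply: squeeze_cvgr (cvg_cst 0) c0.
  near=> h; rewrite normr_ge0/= addr0 /expinv ltxx subr0.
  case: ifPn => h0; last by rewrite scaler0 normr0 mulr_ge0// (le_trans _ (HC 0 _)).
  have := HC h^-1; rewrite invr_ge0 (ltW h0) => /(_ isT).
  rewrite hornerM hornerXn exprVn -mulrA !normrM.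
  move: (`|p.[_]| * _) => A; rewrite !ger0_norm ?invr_ge0 ?exprn_ge0 ?(ltW h0)// => AC.
  have -> : h^-1 * A = h * (h ^- 2 * A) by field; rewrite gt_eqF.
  by rewrite mulrC ler_wpM2r// ltW.
Unshelve. all: by end_near. Qed.

Lemma Cinf_expinv (p : {poly R}) : Cinf (expinv p).
Proof.
move=> n; elim: n p => [//|n IH] p.
have diff_f x : differentiable (expinv p) x.
  by apply/derivable1_diffP; exact: (@ex_derive _ _ _ _ _ _ _ (is_derive_expinv p x)).
split => // v; apply: Cn_ext (CnM (Cn_cst n v) (IH ('X^2 * (p - p^`())))) => x.
have [_ <-] := is_derive_expinv p x; rewrite !deriveE//.
by rewrite -[in RHS](mulr1 v) linearZ.
Qed.

End Smooth.

Section SmoothLine.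
Context {R : realType}.
Implicit Types (f g : R -> R).

Lemma Cinf_derive1 f : Cinf f -> Cinf (derive1 f).
Proof.
move=> Cf; have -> : (derive1 f) = 'D_(1 : R) f by apply/funext => x; rewrite derive1E.
exact: Cinf_derive.
Qed.

Lemma Cinf_is_derive1 f (x : R) : Cinf f -> is_derive x (1 : R) f ((derive1 f) x).
Proof. by move=> Cf; rewrite derive1E; exact: Cinf_is_derive. Qed.

Lemma derive1_locally_cst f (c x : R) :
  (\forall y \near x, f y = c) -> derive1 f x = 0.
Proof.
by move=> f0; rewrite derive1E (@near_eq_derive _ _ _ f (cst c)) ?derive_cst// oner_neq0.
Qed.

Definition Cc f := Cinf f /\ exists A, forall x, A <= `|x| -> f x = 0.

Lemma Cc_derive1 f : Cc f -> Cc (derive1 f).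
Proof.
move=> [Cf [A fA]]; split; first exact: Cinf_derive1.
exists (A + 1) => x xA; rewrite derive1E.
rewrite (@near_eq_derive _ _ _ f (cst 0)) ?derive_cst//.
near=> y; apply: fA; near: y.
have : A < `|x| by rewrite (lt_le_trans _ xA)// ltrDl.
move=> Ax; have : {for x, continuous (fun y : R => `|y|)} by exact: norm_continuous.
by move=> /cvgr_ge; apply.
Unshelve. all: by end_near. Qed.

Lemma Cc_continuous f : Cc f -> continuous f.
Proof. by move=> [/Cinf_continuous]. Qed.

Lemma Cc_bounded f : Cc f -> exists2 C, 0 < C & forall x, `|f x| <= C.
Proof.
move=> Cf; have cf := Cc_continuous Cf; have [_ [A fA]] := Cf.
have [B B0 AB] : exists2 B, 0 <= B & forall x, B <= `|x| -> f x = 0.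
  by exists `|A| => // x Ax; apply: fA; rewrite (le_trans _ Ax)// ler_norm.
have BB : - B <= B by rewrite ge0_cp.
have [c _ Hc] := @EVT_max _ (fun x => `|f x|) _ _ BB
  (continuous_subspaceT (fun x => cvg_norm (cf x))).
exists (`|f c| + 1) => [|x]; first by rewrite ltr_wpDl.
have [xB|xB] := leP B `|x|; first by rewrite AB// normr0 addr_ge0.
by rewrite (le_trans (Hc x _)) ?lerDl// in_itv/= -ler_norml ltW.
Qed.

Lemma Cc_scale f (a : R) : a != 0 -> Cc f -> Cc (fun x => f (a * x)).
Proof.
move=> a0 [Cf [A fA]]; split.
  have := Cinf_lincomb a 0 Cf; congr Cinf; by apply/funext => x; rewrite addr0.
exists (`|a|^-1 * A) => x; rewrite ler_pdivrMl ?normr_gt0// -normrM; exact: fA.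
Qed.

Lemma derive1_scale f (a x : R) : Cinf f ->
  derive1 (fun x => f (a * x)) x = a * (derive1 f) (a * x).
Proof.
move=> Cf; rewrite derive1E; apply: derive_val.
have d : is_derive x (1 : R) (fun x => a * x) a.
  by apply: is_derive_eq; rewrite /GRing.scale /= mulr1.
by rewrite mulrC; exact: (@is_derive1_comp _ f _ x _ _ (Cinf_is_derive1 _ Cf) d).
Qed.

Lemma CcM f g : Cc f -> Cinf g -> Cc (fun x => f x * g x).
Proof.
move=> [Cf [A fA]] Cg; split; first exact: CinfM.
by exists A => x Ax; rewrite fA// mul0r.
Qed.

(** Positive exactly on ]a, b[ and not normalised; [expinv 1] is the classical exp(-1/x), extended
    by 0 to x <= 0. *)
Definition smooth_bump (a b x : R) : R := expinv 1 (x - a) * expinv 1 (b - x).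

Lemma Cinf_smooth_bump a b : Cinf (smooth_bump a b).
Proof.
apply: CinfM.
  have := Cinf_lincomb 1 (- a) (Cinf_expinv 1).
  by congr Cinf; apply/funext => x; rewrite mul1r.
have := Cinf_lincomb (- 1) b (Cinf_expinv 1).
by congr Cinf; apply/funext => x; rewrite mulN1r addrC.
Qed.

Lemma expinv1_ge0 (x : R) : 0 <= expinv 1 x.
Proof. by rewrite /expinv; case: ifP => // _; rewrite hornerC mul1r expR_ge0. Qed.

Lemma smooth_bump_ge0 a b x : 0 <= smooth_bump a b x.
Proof. by rewrite mulr_ge0// expinv1_ge0. Qed.

Lemma smooth_bump_gt0 a b x : a < x -> x < b -> 0 < smooth_bump a b x.
Proof.
move=> ax xb; rewrite /smooth_bump /expinv !subr_gt0 ax xb !hornerC !mul1r.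
by rewrite mulr_gt0 ?expR_gt0.
Qed.

Lemma smooth_bump_out a b x : (x <= a) || (b <= x) -> smooth_bump a b x = 0.
Proof.
rewrite /smooth_bump /expinv !subr_gt0 => /orP[|]; rewrite leNgt => /negbTE ->.
  by rewrite mul0r.
by rewrite mulr0.
Qed.

Lemma Cc_smooth_bump a b : Cc (smooth_bump a b).
Proof.
split; first exact: Cinf_smooth_bump.
exists (`|a| + `|b|) => x abx; apply: smooth_bump_out; apply/negPn/negP.
rewrite negb_or -!ltNge => /andP[ax xb].
suff : `|x| < `|a| + `|b| by rewrite ltNge abx.
have [x0|x0] := leP 0 x.
  by rewrite ger0_norm// (lt_le_trans xb)// (le_trans (ler_norm b))// lerDr.
rewrite ltr0_norm// (@lt_le_trans _ _ (- a)) ?ltrN2//.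
by rewrite (le_trans (ler_norm (- a)))// normrN lerDl.
Qed.

Lemma Cinf_cos_sin (a : R) : Cinf (fun x => cos (a * x)) /\ Cinf (fun x => sin (a * x)).
Proof.
(* One joint induction, since each function is the derivative of the other up to sign. *)
suff H n : Cn n (@cos R) /\ Cn n (@sin R).
  split.
    have := Cinf_lincomb a 0 (fun n => (H n).1); congr Cinf; by apply/funext => x; rewrite addr0.
  have := Cinf_lincomb a 0 (fun n => (H n).2); congr Cinf; by apply/funext => x; rewrite addr0.
elim: n => [//|n [IHc IHs]]; split; split.
- by move=> x; apply/derivable1_diffP; exact: ex_derive.
- move=> v; apply: Cn_ext (CnM (Cn_cst n (- v)) IHs) => x.
  rewrite deriveE; last by apply/derivable1_diffP; exact: ex_derive.
  rewrite -[v in RHS]mulr1 [RHS]linearZ /= -deriveE; last by apply/derivable1_diffP; exact: ex_derive.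
  by rewrite derive_val /GRing.scale /= mulrN mulNr.
- by move=> x; apply/derivable1_diffP; exact: ex_derive.
- move=> v; apply: Cn_ext (CnM (Cn_cst n v) IHc) => x.
  rewrite deriveE; last by apply/derivable1_diffP; exact: ex_derive.
  rewrite -[v in RHS]mulr1 [RHS]linearZ /= -deriveE; last by apply/derivable1_diffP; exact: ex_derive.
  by rewrite derive_val.
Qed.

End SmoothLine.

(** * Products W(x) g(y) th(t) as test functions *)

Section Tensor.
Context {R : realType}.
Implicit Types (W g th : R -> R) (psi : R * R * R -> R).

Lemma Cinf_smooth psi : Cinf psi -> smooth psi.
Proof.
move=> Cpsi vs; suff C : Cinf (iter_derive vs psi).
  split; first exact: Cinf_continuous.
  by move=> v w; apply: diff_derivable; exact: Cinf_differentiable.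
by elim: vs => [//|v vs IH] /=; exact: Cinf_derive.
Qed.

Definition tensor W g th : R * R * R -> R := fun w => W w.1.1 * g w.1.2 * th w.2.

(** [is_diff x h h] says that [h] is its own differential; this is how the linearity of the
    coordinate maps enters the chain rule. *)
Lemma is_diff_fst (V1 V2 : normedModType R) (x : V1 * V2) : is_diff x fst fst.
Proof.
have c : continuous (@fst V1 V2) by move=> y; exact: cvg_fst.
pose l : {linear (V1 * V2)%type -> V1} := @fst V1 V2.
have d := @linear_differentiable _ _ _ l x c; have e := @diff_lin _ _ _ l x c.
exact: (@DiffDef _ _ _ _ _ _ _ d e).
Qed.

Lemma is_diff_snd (V1 V2 : normedModType R) (x : V1 * V2) : is_diff x snd snd.
Proof.
have c : continuous (@snd V1 V2) by move=> y; exact: cvg_snd.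
pose l : {linear (V1 * V2)%type -> V2} := @snd V1 V2.
have d := @linear_differentiable _ _ _ l x c; have e := @diff_lin _ _ _ l x c.
exact: (@DiffDef _ _ _ _ _ _ _ d e).
Qed.

Lemma derive_comp_lin (V : normedModType R) (h : V -> R) f (x v : V) :
  is_diff x h h -> Cinf f -> 'D_v (f \o h) x = h v * (derive1 f) (h x).
Proof.
move=> dh Cf; have dfh := Cinf_differentiable (h x) Cf.
rewrite deriveE; last by apply: differentiable_comp => //; exact: ex_diff.
rewrite diff_comp//= diff_val derive1E -[h v in LHS]mulr1 [LHS]linearZ.
by rewrite deriveE.
Qed.

Lemma Cinf_comp_lin (V : normedModType R) (h : V -> R) f :
  (forall x, is_diff x h h) -> Cinf f -> Cinf (f \o h).
Proof.
by move=> dh Cf; apply: (Cinf_comp_affine (L := h)) => // x; exact: diff_val.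
Qed.

Lemma is_diff11 (x : R * R * R) : is_diff x (fun w => w.1.1) (fun w => w.1.1).
Proof. exact: (is_diff_comp (is_diff_fst x) (is_diff_fst x.1)). Qed.
Lemma is_diff12 (x : R * R * R) : is_diff x (fun w => w.1.2) (fun w => w.1.2).
Proof. exact: (is_diff_comp (is_diff_fst x) (is_diff_snd x.1)). Qed.
Lemma is_diff2 (x : R * R * R) : is_diff x (fun w => w.2) (fun w => w.2).
Proof. exact: is_diff_snd. Qed.

Lemma Cinf_tensor W g th : Cinf W -> Cinf g -> Cinf th -> Cinf (tensor W g th).
Proof.
move=> CW Cg Ct; apply: CinfM; first apply: CinfM.
- exact: (Cinf_comp_lin is_diff11 CW).
- exact: (Cinf_comp_lin is_diff12 Cg).
- exact: (Cinf_comp_lin is_diff2 Ct).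
Qed.

Lemma derive_tensor W g th (w v : R * R * R) : Cinf W -> Cinf g -> Cinf th ->
  'D_v (tensor W g th) w = v.1.1 * tensor (derive1 W) g th w
     + v.1.2 * tensor W (derive1 g) th w + v.2 * tensor W g (derive1 th) w.
Proof.
move=> CW Cg Ct.
have d1 := Cinf_differentiable w (Cinf_comp_lin is_diff11 CW).
have d2 := Cinf_differentiable w (Cinf_comp_lin is_diff12 Cg).
have d3 := Cinf_differentiable w (Cinf_comp_lin is_diff2 Ct).
rewrite (@deriveM _ _ ((W \o (fun w => w.1.1)) * (g \o (fun w => w.1.2))) (th \o (fun w => w.2))); last 2 first.
  by apply: diff_derivable; exact: differentiableM.
  by apply: diff_derivable.
rewrite deriveM; [|by apply: diff_derivable|by apply: diff_derivable].
rewrite (derive_comp_lin _ (is_diff2 w) Ct) (derive_comp_lin _ (is_diff12 w) Cg).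
rewrite (derive_comp_lin _ (is_diff11 w) CW).
rewrite /tensor; transitivity (W w.1.1 * g w.1.2 * (v.2 * derive1 th w.2) + th w.2 * (W w.1.1 * (v.1.2 * derive1 g w.1.2) + g w.1.2 * (v.1.1 * derive1 W w.1.1))); first by [].
ring.
Qed.

Lemma d_x_tensor W g th : Cinf W -> Cinf g -> Cinf th ->
  d_x (tensor W g th) = tensor (derive1 W) g th.
Proof.
move=> CW Cg Ct; apply/funext => w; rewrite /d_x derive_tensor//=; ring.
Qed.
Lemma d_y_tensor W g th : Cinf W -> Cinf g -> Cinf th ->
  d_y (tensor W g th) = tensor W (derive1 g) th.
Proof.
move=> CW Cg Ct; apply/funext => w; rewrite /d_y derive_tensor//=; ring.
Qed.
Lemma d_t_tensor W g th : Cinf W -> Cinf g -> Cinf th ->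
  d_t (tensor W g th) = tensor W g (derive1 th).
Proof.
move=> CW Cg Ct; apply/funext => w; rewrite /d_t derive_tensor//=; ring.
Qed.

Lemma test_function_tensor (T a b : R) W g th : 0 < a -> b < T ->
  Cc W -> Cc g -> Cinf th -> (forall t, th t != 0 -> a <= t <= b) ->
  test_function T (tensor W g th).
Proof.
move=> a0 bT [CW [A WA]] [Cg [B gB]] Ct th0.
(* A closed box that contains the points where the product is nonzero, hence their closure. Its time
   side lies inside ]0, T[ because 0 < a and b < T. *)
pose K : set (R * R * R) := (`[- A, A] `*` `[- B, B]) `*` `[a, b].
have cK : compact K.
  by apply: compact_setX; [apply: compact_setX|]; exact: segment_compact.
have clK : closed K by apply: compact_closed => //.
have sK : closure [set w | tensor W g th w != 0] `<=` K.
  rewrite closureE; apply: smallest_sub => // w /=.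
  rewrite /tensor !mulf_eq0 !negb_or => /andP[/andP[W0 g0] t0]; split.
    split; rewrite /= in_itv/= -ler_norml leNgt; apply/negP => /ltW.
      by move=> /WA /eqP; rewrite (negbTE W0).
    by move=> /gB /eqP; rewrite (negbTE g0).
  by rewrite /= in_itv/=; exact: th0.
split.
- exact/Cinf_smooth/Cinf_tensor.
- exact: (subclosed_compact (@closed_closure _ _) cK).
- move=> w /sK [_]; rewrite /= in_itv/= => /andP[aw wb].
  by rewrite (lt_le_trans a0)//= (le_lt_trans wb).
Qed.

End Tensor.

(** * The Hilbert transform of a compactly supported function *)

Section RealIntegrals.
Context d (T : measurableType d) (R : realType) (mu : {measure set T -> \bar R}).
Implicit Types (D : set T) (f g : T -> R).

Lemma dominated_Rintegrable D f g : measurable D -> measurable_fun D f ->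
  mu.-integrable D (EFin \o g) -> (forall x, D x -> `|f x| <= g x) ->
  mu.-integrable D (EFin \o f).
Proof.
move=> mD mf ig fg; apply: (le_integrable mD _ _ ig); first exact/measurable_EFinP.
by move=> x Dx /=; rewrite lee_fin (le_trans (fg _ Dx))// ler_norm.
Qed.

Lemma Rdominated_convergence D (f_ : nat -> T -> R) f g : measurable D ->
  (forall n, measurable_fun D (f_ n)) ->
  (forall x, D x -> f_ n x @[n --> \oo] --> f x) ->
  mu.-integrable D (EFin \o g) -> (forall n x, D x -> `|f_ n x| <= g x) ->
  \int[mu]_(x in D) f_ n x @[n --> \oo] --> \int[mu]_(x in D) f x.
Proof.
move=> mD mf_ ff ig fg.
have mEf_ n : measurable_fun D (EFin \o f_ n) by exact/measurable_EFinP.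
have ff' x : D x -> (EFin \o f_ n) x @[n --> \oo] --> (EFin \o f) x.
  by move=> Dx; apply/fine_cvgP; split; [exact: nearW|exact: ff].
have mf : measurable_fun D (EFin \o f) by exact: emeasurable_fun_cvg mEf_ ff'.
have fg' n x : D x -> (`|(EFin \o f_ n) x| <= (EFin \o g) x)%E.
  by move=> Dx; rewrite lee_fin fg.
have [iF _ cF] := @dominated_convergence _ _ _ mu D mD (fun n => EFin \o f_ n)
   (EFin \o f) (EFin \o g) mEf_ mf (aeW _ ff') ig (aeW _ (fun x n => fg' n x)).
by apply: fine_cvg; rewrite fineK//; apply: integrable_fin_num.
Qed.

Lemma integrable_disjU (A B : set T) f : measurable A -> measurable B ->
  [disjoint A & B] -> mu.-integrable A (EFin \o f) -> mu.-integrable B (EFin \o f) ->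
  mu.-integrable (A `|` B) (EFin \o f).
Proof.
move=> mA mB AB /integrableP[mfA iA] /integrableP[mfB iB].
have mf : measurable_fun (A `|` B) (EFin \o f) by exact/measurable_funU.
apply/integrableP; split => //.
rewrite ge0_integral_setU//; first exact: lte_add_pinfty.
exact: measurableT_comp.
Qed.

End RealIntegrals.

Section AffineSubstitution.
Context {R : realType}.
Notation mu := (@lebesgue_measure R).

Lemma is_derive_affine (k x s : R) : is_derive s (1 : R) (fun s => k * s + x) k.
Proof.
have -> : (fun s => k * s + x) = (k \*: id) + cst x by [].
by apply: is_derive_eq; rewrite /GRing.scale /= mulr1 addr0.
Qed.

Lemma derive1_affine (k x : R) : derive1 (fun s : R => k * s + x) = cst k.
Proof. by apply/funext => s; rewrite derive1E; apply: (@derive_val _ _ _ _ _ _ _ (is_derive_affine k x s)). Qed.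

Lemma affine_LR (k x c e : R) : derivable_oo_LRcontinuous (fun s => k * s + x) c e.
Proof.
have cont : continuous (fun s : R => k * s + x).
  move=> s; apply/differentiable_continuous/derivable1_diffP.
  exact: (@ex_derive _ _ _ _ _ _ _ (is_derive_affine k x s)).
split.
- by move=> s _; exact: (@ex_derive _ _ _ _ _ _ _ (is_derive_affine k x s)).
- by apply: cvg_at_right_filter; exact: cont.
- by apply: cvg_at_left_filter; exact: cont.
Qed.

Lemma Rintegral_affine (G : R -> R) (k x c e : R) : 0 < k -> c <= e ->
  {within `[k * c + x, k * e + x], continuous G} ->
  \int[mu]_(z in `[k * c + x, k * e + x]) G z = \int[mu]_(s in `[c, e]) (G (k * s + x) * k).
Proof.
move=> k0 ce cG; rewrite /Rintegral.
have := @integration_by_substitution_increasing R (fun s => k * s + x) G c e ce.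
rewrite derive1_affine => ->//.
- by move=> s t _ _ st; rewrite ltrD2r ltr_pM2l.
- by move=> s _; exact: cvg_cst.
- exact: is_cvg_cst.
- exact: is_cvg_cst.
- exact: affine_LR.
Qed.

Lemma Rintegral_reflect (G : R -> R) (x c e : R) : c <= e ->
  {within `[x - e, x - c], continuous G} ->
  \int[mu]_(z in `[x - e, x - c]) G z = \int[mu]_(s in `[c, e]) G (x - s).
Proof.
move=> ce cG; rewrite /Rintegral.
have E s : x - s = -1 * s + x by rewrite mulN1r addrC.
have := @integration_by_substitution_decreasing R (fun s => -1 * s + x) G c e ce.
rewrite derive1_affine -!E => ->//.
- by congr fine; apply: eq_integral => s _; rewrite /= !E /= opprK mulr1.
- by move=> s t _ _ st; rewrite -!E ltrD2l ltrN2.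
- by move=> s _; exact: cvg_cst.
- exact: is_cvg_cst.
- exact: is_cvg_cst.
- exact: affine_LR.
Qed.

End AffineSubstitution.

(** * The principal value as an absolutely convergent integral *)

Section HilbertLine.
Context {R : realType}.
Notation mu := (@lebesgue_measure R).
Implicit Types (phi : R -> R) (x s e M L A : R).

Definition pvq phi x s : R := (phi (x - s) - phi (x + s)) / s.

(* The principal value, with both sides of the singularity folded together. *)
Definition Hil phi x : R := \int[mu]_(s in `]0, +oo[) pvq phi x s.

(** The data behind all estimates of [Hil]: the Lipschitz constant bounds the folded quotient by 2 L
    near s = 0, and the support bound makes it vanish for s >= |x| + A. The integral is therefore
    that of a bounded function over a bounded interval. *)
Record pvdata phi A L : Prop := PvData {
  pv_A : 0 <= A;
  pv_L : 0 <= L;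
  pv_cont : continuous phi;
  pv_supp : forall x, A <= `|x| -> phi x = 0;
  pv_lip : forall x y, `|phi x - phi y| <= L * `|x - y| }.

Lemma Cc_lipschitz phi : Cc phi ->
  exists2 L, 0 <= L & forall x y, `|phi x - phi y| <= L * `|x - y|.
Proof.
move=> Cphi; have [L L0 HL] := Cc_bounded (Cc_derive1 Cphi).
exists L; first exact: ltW.
suff H x y : x <= y -> `|phi y - phi x| <= L * `|y - x|.
  move=> x y; have [xy|/ltW yx] := leP y x; first exact: H.
  by rewrite distrC (distrC x); exact: H.
move=> xy; have Cf := Cphi.1.
have [c _ ->] := @MVT_segment _ phi (derive1 phi) _ _ xy
  (fun z _ => Cinf_is_derive1 z Cf) (continuous_subspaceT (Cc_continuous Cphi)).
by rewrite normrM ler_wpM2r.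
Qed.

Lemma Cc_pvdata phi : Cc phi -> exists A L, pvdata phi A L.
Proof.
move=> Cphi; have [L L0 HL] := Cc_lipschitz Cphi; have [_ [A HA]] := Cphi.
exists `|A|, L; split => //; first exact: Cc_continuous.
by move=> x Ax; apply: HA; rewrite (le_trans _ Ax)// ler_norm.
Qed.

Lemma pvq_le phi A L x s : pvdata phi A L -> 0 < s -> `|pvq phi x s| <= 2 * L.
Proof.
move=> [_ _ _ _ lip] s0; rewrite normrM normfV (gtr0_norm s0) ler_pdivrMr//.
rewrite (le_trans (lip _ _))//.
have -> : x - s - (x + s) = - (2 * s) by ring.
by rewrite normrN gtr0_norm ?mulr_gt0// mulrCA mulrA.
Qed.

Lemma pvq_eq0 phi A L x s : pvdata phi A L -> `|x| + A <= s -> pvq phi x s = 0.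
Proof.
move=> [A0 _ _ supp _] xs.
have s0 : 0 <= s by rewrite (le_trans _ xs)// addr_ge0.
have [x1 x2] : x <= `|x| /\ - x <= `|x| by rewrite ler_norm -normrN ler_norm.
have h1 : A <= `|x - s| by rewrite distrC (le_trans _ (ler_norm _))//; lra.
have h2 : A <= `|x + s| by rewrite (le_trans _ (ler_norm _))//; lra.
by rewrite /pvq (supp _ h1) (supp _ h2) subrr mul0r.
Qed.

Lemma pvq_continuous phi A L x s : pvdata phi A L -> 0 < s ->
  {for s, continuous (pvq phi x)}.
Proof.
move=> [_ _ c _ _] s0; apply: cvgM; last first.
  by apply: cvgV; [rewrite gt_eqF|exact: cvg_id].
apply: cvgB.
  apply: (@cvg_comp _ _ _ (fun s => x - s) phi); last exact: c.
  by apply: cvgB; [exact: cvg_cst|exact: cvg_id].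
apply: (@cvg_comp _ _ _ (fun s => x + s) phi); last exact: c.
by apply: cvgD; [exact: cvg_cst|exact: cvg_id].
Qed.

Lemma pvq_continuous_x phi A L s : pvdata phi A L -> continuous (pvq phi ^~ s).
Proof.
move=> [_ _ c _ _] x; apply: cvgM; last exact: cvg_cst.
apply: cvgB.
  apply: (@cvg_comp _ _ _ (fun x => x - s) phi); last exact: c.
  by apply: cvgB; [exact: cvg_id|exact: cvg_cst].
apply: (@cvg_comp _ _ _ (fun x => x + s) phi); last exact: c.
by apply: cvgD; [exact: cvg_id|exact: cvg_cst].
Qed.

Lemma pvq_measurable phi A L x : pvdata phi A L ->
  measurable_fun (`]0, +oo[%classic : set R) (pvq phi x).
Proof.
move=> P; apply: open_continuous_measurable_fun; first exact: interval_open.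
move=> s; rewrite inE/= in_itv/= andbT => s0.
have := @pvq_continuous phi A L x s P s0.
exact.
Qed.

Lemma pvq_dom phi A L x M s : pvdata phi A L -> `|x| + A <= M -> 0 < s ->
  `|pvq phi x s| <= 2 * L * \1_(`[0, M]%classic) s.
Proof.
move=> P xM s0; rewrite indicE; have [|] := boolP (s \in _) => sM.
  by rewrite mulr1; exact: (pvq_le _ P s0).
rewrite (pvq_eq0 P) ?normr0 ?mulr0//.
move: sM; rewrite notin_setE/= in_itv/= (ltW s0)/= => /negP.
by rewrite -ltNge => /ltW; exact: le_trans.
Qed.

Lemma indic_dom_integrable (k M : R) :
  mu.-integrable `]0, +oo[ (EFin \o (fun s => k * \1_(`[0, M]%classic) s)).
Proof.
apply: (@integrableS _ _ _ mu setT) => //.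
exact: (integrableZl _ k (integrable_indic_itv 0 M true false)).
Qed.

Lemma pvq_integrable phi A L x : pvdata phi A L ->
  mu.-integrable `]0, +oo[ (EFin \o pvq phi x).
Proof.
move=> P; apply: dominated_Rintegrable => //.
- exact: (pvq_measurable x P).
- exact: (indic_dom_integrable (2 * L) (`|x| + A)).
by move=> s /=; rewrite in_itv/= andbT; exact: (pvq_dom P).
Qed.

Lemma Hil_restrict phi A L x M : pvdata phi A L -> `|x| + A <= M ->
  Hil phi x = \int[mu]_(s in `]0, M]) pvq phi x s.
Proof.
move=> P xM; have -> : `]0, M]%classic = `]0, +oo[%classic `&` `]0, M]%classic :> set R.
  apply/seteqP; split => s /=; rewrite !in_itv/= ?andbT; last by case.
  by move=> /andP[-> ->].
rewrite Rintegral_mkcondr; apply: eq_Rintegral => s; rewrite inE/= in_itv/= andbT => s0.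
rewrite patchE; case: ifPn => //; rewrite notin_setE/= in_itv/= s0/= => /negP.
by rewrite -ltNge => /ltW /(le_trans xM) h; rewrite (pvq_eq0 P h).
Qed.

Lemma cst_integrable (k a b : R) (b0 b1 : bool) :
  mu.-integrable [set` Interval (BSide b0 a) (BSide b1 b)] (EFin \o cst k).
Proof.
apply: (@integrableS _ _ _ mu `[a, b]) => //.
  move=> x /=; rewrite !in_itv/=; by move=> /andP[/lteifW -> /lteifW ->].
apply: continuous_compact_integrable; first exact: segment_compact.
by apply: continuous_subspaceT => x; exact: cvg_cst.
Qed.

Lemma Rintegral_norm_le (f : R -> R) (k a b : R) (b0 b1 : bool)
    (I := [set` Interval (BSide b0 a) (BSide b1 b)]) : a <= b ->
  mu.-integrable I (EFin \o f) -> (forall x, I x -> `|f x| <= k) ->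
  `|\int[mu]_(x in I) f x| <= k * (b - a).
Proof.
move=> ab If fk; have mI : measurable (I : set (measurableTypeR R)) by exact: measurable_itv.
rewrite (le_trans (le_normr_Rintegral mI If))//.
have Ik := cst_integrable k a b b0 b1.
apply: (le_trans (le_Rintegral mI (integrable_norm If) Ik _)) => //.
have muI : fine (mu I) = b - a.
  rewrite /I lebesgue_measure_itv/= lte_fin; case: ifPn => //=.
  by rewrite -leNgt => ba; rewrite (@le_anti _ _ a b) ?ab ?ba// subrr.
by rewrite (Rintegral_cst _ mI) muI.
Qed.

Lemma Hil_bound phi A L x : pvdata phi A L -> `|Hil phi x| <= 2 * L * (`|x| + A).
Proof.
move=> P; rewrite (Hil_restrict P (lexx _)) -[X in _ * X]subr0.
apply: Rintegral_norm_le; first by rewrite addr_ge0// (pv_A P).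
  by apply: (integrableS _ _ _ (pvq_integrable x P)) => //; exact: subset_itvl.
by move=> s /=; rewrite in_itv/= => /andP[s0 _]; exact: (pvq_le _ P s0).
Qed.

Lemma Hil_continuous phi A L : pvdata phi A L -> continuous (Hil phi).
Proof.
move=> P x; pose M := `|x| + 1 + A.
apply: (@continuity_under_integral _ _ _ mu (pvq phi) `]0, +oo[ _ (x - 1) (x + 1) _ _ (fun s => 2 * L * \1_(`[0, M]%classic) s)) => //.
- by move=> y _; exact: (pvq_integrable _ P).
- apply: aeW => s _ y _; exact: (pvq_continuous_x (s := s) P).
- exact: indic_dom_integrable.
- move=> y; rewrite /= in_itv/= => /andP[y1 y2].
  apply: aeW => s; rewrite /= in_itv/= andbT => s0; apply: (pvq_dom P) => //.
  rewrite /M lerD2r.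
  have [x1 x2] : x <= `|x| /\ - x <= `|x| by rewrite ler_norm -normrN ler_norm.
  by rewrite ler_norml; apply/andP; split; lra.
- by rewrite inE/= in_itv/=; apply/andP; split; lra.
Qed.

(** The folded quotient is at most 2 L, so leaving out ]0, e[ costs at most 2 L e. On [[e, M]] the
    integrand is continuous, which is what the changes of variable require. *)
Lemma Hil_approx phi A L x e M : pvdata phi A L -> 0 < e -> e < M -> `|x| + A <= M ->
  `|Hil phi x - \int[mu]_(s in `[e, M]) pvq phi x s| <= 2 * L * e.
Proof.
move=> P e0 eM xM; rewrite (Hil_restrict P xM).
have i1 : mu.-integrable `]0, M] (EFin \o pvq phi x).
  by apply: (integrableS _ _ _ (pvq_integrable x P)) => //; exact: subset_itvl.
have E : `]0, M]%classic = `]0, e[%classic `|` `[e, M]%classic :> set R.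
  apply/seteqP; split => s /=; rewrite !in_itv/=.
    by move=> /andP[-> ->]; rewrite andbT; have [|] := ltP s e; [left|right].
  move=> [/andP[-> se]|/andP[es ->]]; first by rewrite (ltW (lt_trans se eM)).
  by rewrite (lt_le_trans e0).
rewrite {1}E Rintegral_setU -?E//; last first.
  by apply/disj_setPS => s [] /=; rewrite !in_itv/= => /andP[_ se] /andP[]; rewrite leNgt se.
rewrite addrK -[X in _ * X]subr0; apply: Rintegral_norm_le; first exact: ltW.
  apply: (integrableS _ _ _ i1) => // s; rewrite /= !in_itv/= => /andP[-> se].
  by rewrite (ltW (lt_trans se eM)).
by move=> s /=; rewrite in_itv/= => /andP[s0 _]; exact: (pvq_le _ P s0).
Qed.

Lemma pvq_integral_scale phi A L x (a e M : R) : pvdata phi A L -> 0 < a -> 0 < e -> e <= M ->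
  \int[mu]_(s in `[e, M]) pvq (fun z => phi (a * z)) x s =
  \int[mu]_(s in `[a * e, a * M]) pvq phi (a * x) s.
Proof.
move=> P a0 e0 eM; rewrite -(addr0 (a * e)) -(addr0 (a * M)) Rintegral_affine//.
  apply: eq_Rintegral => s; rewrite inE/= in_itv/= => /andP[es _].
  rewrite /pvq addr0 mulrBr mulrDr -mulrA; congr (_ * _).
  by field; rewrite !gt_eqF// (lt_le_trans e0).
apply: continuous_in_subspaceT => s; rewrite inE/= !addr0 in_itv/= => /andP[es _].
apply: (@pvq_continuous phi A L (a * x) s P).
by rewrite (lt_le_trans _ es)// mulr_gt0.
Qed.

Lemma eq_of_small (a b k e0 : R) : 0 < e0 ->
  (forall e, 0 < e -> e < e0 -> `|a - b| <= k * e) -> a = b.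
Proof.
move=> e00 H; apply/eqP; rewrite -subr_eq0 -normr_le0; apply/ler_addgt0Pl => d d0.
pose e := Num.min (e0 / 2) (d / (`|k| + 1)).
have e_gt0 : 0 < e by rewrite lt_min !divr_gt0// ltr_wpDl.
have ee0 : e < e0 by rewrite /e gt_min ltr_pdivrMr// ltr_pMr// ltr1n.
rewrite addr0 (le_trans (H _ e_gt0 ee0))//.
rewrite (@le_trans _ _ ((`|k| + 1) * e))//.
  by rewrite ler_wpM2r ?(ltW e_gt0)// (le_trans (ler_norm k))// lerDl.
by rewrite -ler_pdivlMl ?ltr_wpDl// mulrC ge_min lexx orbT.
Qed.

(** The measure ds / s is invariant under dilations. The substitution is exact on [[e, M]], and the
    two truncations err by O(e), so the two values agree by [eq_of_small]. *)
Lemma Hil_scale phi A L A' L' x (a : R) : 0 < a -> pvdata phi A L ->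
  pvdata (fun z => phi (a * z)) A' L' ->
  Hil (fun z => phi (a * z)) x = Hil phi (a * x).
Proof.
(* One cutoff for both sides: [M1] passes the support of the dilated function; [M2] is divided by
   [a] because the other integral is cut at a M; the 1 ensures e < M. *)
move=> a0 P P'; pose M1 := `|x| + A'; pose M2 := (`|a * x| + A) / a.
pose M := Num.max (Num.max M1 M2) 1.
apply: (@eq_of_small _ _ (2 * L' + 2 * L * a) 1) => // e e0 e1.
have eM : e < M by rewrite lt_max e1 orbT.
have h1 := Hil_approx P' e0 eM; have /h1 {}h1 : M1 <= M by rewrite !le_max lexx.
have ae0 : 0 < a * e by rewrite mulr_gt0.
have aeM : a * e < a * M by rewrite ltr_pM2l.
have h2 := Hil_approx (x := a * x) P ae0 aeM.
have /h2 {}h2 : `|a * x| + A <= a * M by rewrite (mulrC a M) -ler_pdivrMr// !le_max lexx orbT.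
rewrite -(pvq_integral_scale x P a0 e0 (ltW eM)) in h2.
move: h1 h2; set J := Rintegral _ _ _ => h1 h2.
rewrite distrC in h2; rewrite (le_trans (ler_distD J _ _))// (le_trans (lerD h1 h2))//.
by rewrite le_eqVlt; apply/orP; left; apply/eqP; ring.
Qed.

(** The two sides of the singularity become integrals over [[e, M]] by z = x - s and z = x + s, and
    their sum is the integral of the folded quotient. Convergence then comes from [Hil_approx]. *)
Lemma pv_cvg phi A L x : pvdata phi A L ->
  (fun e : R => \int[mu]_(z in [set z : measurableTypeR R | e < `|x - z|])
     (phi z / (x - z))) @ 0^'+ --> Hil phi x.
Proof.
(* The + 1 keeps M positive even if x = 0 and A = 0, so that e < M for small e. *)
move=> P; pose M := `|x| + A + 1.
have cut e : 0 < e -> e < M -> \int[mu]_(z in [set z : measurableTypeR R | e < `|x - z|])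
     (phi z / (x - z)) = \int[mu]_(s in `[e, M]) pvq phi x s.
  move=> e0 eM; pose h z := phi z / (x - z).
  have ch z : z != x -> {for z, continuous h}.
    move=> zx; apply: cvgM; first exact: (pv_cont P).
    apply: cvgV; first by rewrite subr_eq0 eq_sym.
    by apply: cvgB; [exact: cvg_cst|exact: cvg_id].
  have E : [set z : measurableTypeR R | e < `|x - z|] `&` `[x - M, x + M] =
      `[x - M, x - e[ `|` `]x + e, x + M].
    apply/seteqP; split => z /=; rewrite !in_itv/=.
      move=> [xz /andP[z1 z2]]; rewrite z1 z2/= andbT.
      have [zx|/ltW zx] := leP z x.
        by left; move: xz; rewrite ger0_norm ?subr_ge0//; lra.
      by right; move: xz; rewrite ler0_norm ?subr_le0//; lra.
    move=> [/andP[z1 z2]|/andP[z1 z2]].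
      by split; [rewrite ger0_norm|apply/andP; split]; lra.
    by split; [rewrite ler0_norm|apply/andP; split]; lra.
  have ->: \int[mu]_(z in [set z : measurableTypeR R | e < `|x - z|]) h z =
     \int[mu]_(z in [set z : measurableTypeR R | e < `|x - z|] `&` `[x - M, x + M]) h z.
    rewrite Rintegral_mkcondr; apply: eq_Rintegral => z; rewrite inE/= => xz.
    rewrite patchE; case: ifPn => //; rewrite notin_setE/= in_itv/= => /negP zM.
    rewrite /h (pv_supp P) ?mul0r// leNgt; apply/negP => zA; move/negP: zM; apply.
    move: zA; rewrite ltr_norml /M => /andP[z1 z2].
    have [x1 x2] : x <= `|x| /\ - x <= `|x| by rewrite ler_norm -normrN ler_norm.
    by apply/andP; split; lra.
  rewrite E.
  have c1 : {within `[x - M, x - e], continuous h}.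
    apply: continuous_in_subspaceT => z; rewrite inE/= in_itv/= => /andP[_ z2].
    by apply: ch; rewrite lt_eqF// (le_lt_trans z2)// gtrBl.
  have c2 : {within `[x + e, x + M], continuous h}.
    apply: continuous_in_subspaceT => z; rewrite inE/= in_itv/= => /andP[z1 _].
    by apply: ch; rewrite gt_eqF// (lt_le_trans _ z1)// ltrDl.
  have i1 : mu.-integrable `[x - M, x - e] (EFin \o h).
    by apply: continuous_compact_integrable => //; exact: segment_compact.
  have i2 : mu.-integrable `[x + e, x + M] (EFin \o h).
    by apply: continuous_compact_integrable => //; exact: segment_compact.
  have i1' : mu.-integrable `[x - M, x - e[ (EFin \o h).
    by apply: (integrableS _ _ _ i1) => //; exact: subset_itv_co_cc.
  have i2' : mu.-integrable `]x + e, x + M] (EFin \o h).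
    by apply: (integrableS _ _ _ i2) => //; exact: subset_itv_oc_cc.
  have disj : [disjoint `[x - M, x - e[%classic & `]x + e, x + M]%classic].
    by apply/disj_setPS => z [] /=; rewrite !in_itv/= => /andP[_ z1] /andP[z2 _]; lra.
  rewrite Rintegral_setU//; last first.
  - exact: integrable_disjU.
  rewrite Rintegral_itv_bndo_bndc// Rintegral_itv_obnd_cbnd//.
  rewrite (Rintegral_reflect (ltW eM) c1).
  have := @Rintegral_affine _ h 1 x e M ltr01 (ltW eM).
  rewrite !mul1r !(addrC _ x) => -> //.
  have j1 : mu.-integrable `[e, M] (EFin \o (fun s => h (x - s))).
    apply: continuous_compact_integrable; first exact: segment_compact.
    apply: continuous_in_subspaceT => s; rewrite inE/= in_itv/= => /andP[s1 _].
    apply: (@cvg_comp _ _ _ (fun s => x - s) h).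
      by apply: cvgB; [exact: cvg_cst|exact: cvg_id].
    by apply: ch; rewrite lt_eqF// gtrBl (lt_le_trans e0).
  have j2 : mu.-integrable `[e, M] (EFin \o (fun s => h (1 * s + x) * 1)).
    apply: continuous_compact_integrable; first exact: segment_compact.
    apply: continuous_in_subspaceT => s; rewrite inE/= in_itv/= => /andP[s1 _].
    apply: cvgM; last exact: cvg_cst.
    apply: (@cvg_comp _ _ _ (fun s => 1 * s + x) h).
      by apply: cvgD; [apply: cvgM; [exact: cvg_cst|exact: cvg_id]|exact: cvg_cst].
    by apply: ch; rewrite mul1r gt_eqF// ltrDr (lt_le_trans e0).
  rewrite -RintegralD//; apply: eq_Rintegral => s; rewrite inE/= in_itv/= => /andP[es _].
  have e1 : x - (x - s) = s by ring.
  have e2 : x - (1 * s + x) = - s by ring.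
  have e3 : 1 * s + x = x + s by ring.
  by rewrite /h /pvq e1 e2 e3 invrN; ring.
apply/cvgrPdist_le => d d0.
have L0 := pv_L P; have A0 := pv_A P.
near=> e.
have e0 : 0 < e by [].
have eM : e < M by near: e; apply: nbhs_right_lt; rewrite ltr_wpDl// addr_ge0.
rewrite cut// (le_trans (Hil_approx P e0 eM _))//; first by rewrite lerDl.
have ed : e <= d / (2 * L + 1).
  by near: e; apply: nbhs_right_le; rewrite divr_gt0// ltr_wpDl// mulr_ge0.
move: ed; rewrite ler_pdivlMr ?ltr_wpDl ?mulr_ge0// mulrDr mulr1 mulrC.
by apply: le_trans; rewrite lerDl ltW.
Unshelve. all: by end_near. Qed.

Lemma Hil_cZ phi A L x k : pvdata phi A L -> Hil (fun z => k * phi z) x = k * Hil phi x.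
Proof.
move=> P; rewrite /Hil -RintegralZl//; last exact: (pvq_integrable _ P).
by apply: eq_Rintegral => s _; rewrite /pvq; ring.
Qed.

Lemma pvdataZ phi A L k : pvdata phi A L -> pvdata (fun z => k * phi z) A (`|k| * L).
Proof.
move=> [A0 L0 c supp lip]; split => //.
- by rewrite mulr_ge0.
- by move=> x; apply: cvgM; [exact: cvg_cst|exact: c].
- by move=> x Ax; rewrite supp// mulr0.
- by move=> x y; rewrite -mulrBr normrM -mulrA ler_wpM2l.
Qed.

(** The factor 1/pi belongs to [hilbert_x] and not to [Hil], so it surfaces here. A function of y
    alone passes through, as only x is transformed. *)
Lemma hilbert_x_tensor phi A L (k : R -> R) p : pvdata phi A L ->
  hilbert_x (fun q => k q.2 * phi q.1) p = pi^-1 * (k p.2 * Hil phi p.1).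
Proof.
move=> P; rewrite /hilbert_x -(Hil_cZ _ _ P); congr (_ * _).
have H := pv_cvg (x := p.1) (pvdataZ (k p.2) P).
by apply: cvg_lim => //; exact: H.
Qed.

End HilbertLine.

(** * A one-sided bump w with H w''(0) nonzero *)

Section Dipole.
Context {R : realType}.
Notation mu := (@lebesgue_measure R).

Definition w0 : R -> R := smooth_bump 1 2.

Lemma w0_derive_out (x : R) : x < 1 \/ 2 < x ->
  derive1 w0 x = 0 /\ derive1 (derive1 w0) x = 0.
Proof.
have H (y : R) : y < 1 \/ 2 < y -> \forall z \near y, z < 1 \/ 2 < z.
  case=> y1; near=> z; first by left; near: z; exact: lt_nbhsl.
  by right; near: z; exact: lt_nbhsr.
have D (y : R) : y < 1 \/ 2 < y -> derive1 w0 y = 0.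
  move=> /H Hy; apply: (@derive1_locally_cst _ _ 0); apply: filterS Hy => z zo.
  by apply: smooth_bump_out; apply/orP; case: zo => /ltW; [left|right].
move=> xo; split; first exact: D.
by apply: (@derive1_locally_cst _ _ 0); apply: filterS (H _ xo).
Unshelve. all: by end_near. Qed.

Lemma quotient_continuous (f : R -> R) k (s : R) : continuous f -> 0 < s ->
  {for s, continuous (fun s => f s / s ^+ k)}.
Proof.
move=> cf s0; apply: cvgM; first exact: cf.
apply: cvgV; first by rewrite expf_neq0// gt_eqF.
exact: exprn_continuous.
Qed.

Lemma quotient_integrable (f : R -> R) k : continuous f ->
  mu.-integrable `[2^-1, 3] (EFin \o (fun s => f s / s ^+ k)).
Proof.
move=> cf; apply: continuous_compact_integrable; first exact: segment_compact.
apply: continuous_in_subspaceT => s; rewrite inE/= in_itv/= => /andP[s1 _].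
have s0 : 0 < s by rewrite (lt_le_trans _ s1)// invr_gt0.
have := @quotient_continuous f k s cf s0; exact.
Qed.

(* Two integrations by parts; the right-hand side is visibly positive. *)
Lemma w0_moment : \int[mu]_(s in `[2^-1, 3]) (derive1 (derive1 w0) s / s) =
  2 * \int[mu]_(s in `[2^-1, 3]) (w0 s / s ^+ 3).
Proof.
have C0 : Cinf w0 by exact: Cinf_smooth_bump.
have C1 := Cinf_derive1 C0; have C2 := Cinf_derive1 C1.
(* G is an antiderivative of w''/s - 2 w/s^3: the two terms w'/s^2 cancel. It vanishes at 1/2 and at
   3 because the segment is strictly larger than [1, 2]. *)
pose G s := derive1 w0 s / s + w0 s / s ^+ 2.
pose g1 s := derive1 (derive1 w0) s / s.
pose g2 s := w0 s / s ^+ 3.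
pose g s := g1 s - 2 * g2 s.
have pos (s : R) : s \in `[2^-1, 3] -> 0 < s.
  by rewrite in_itv/= => /andP[s1 _]; rewrite (lt_le_trans _ s1)// invr_gt0.
have cg1 : {in `[2^-1, 3], continuous g1}.
  by move=> s /pos s0; have := @quotient_continuous _ 1 s (Cinf_continuous C2) s0; exact.
have cg2 : {in `[2^-1, 3], continuous g2}.
  by move=> s /pos s0; have := @quotient_continuous _ 3 s (Cinf_continuous C0) s0; exact.
have i1 : mu.-integrable `[2^-1, 3] (EFin \o g1).
  exact: (quotient_integrable 1 (Cinf_continuous C2)).
have i2 : mu.-integrable `[2^-1, 3] (EFin \o g2).
  exact: (quotient_integrable 3 (Cinf_continuous C0)).
have i3 : mu.-integrable `[2^-1, 3] (EFin \o (fun s => 2 * g2 s)).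
  exact: (integrableZl _ 2 i2).
apply/eqP; rewrite -subr_eq0 -RintegralZl// -RintegralB//.
have dG (s : R) : 0 < s -> is_derive s (1 : R) G (g s).
  move=> s0; have sn : s != 0 by rewrite gt_eqF.
  have d0 := Cinf_is_derive1 s C0; have d1 := Cinf_is_derive1 s C1.
  have dV : is_derive s (1 : R) (fun y : R => y^-1) (- s ^- 2).
    by apply: is_derive_eq; [exact: is_deriveV|rewrite /GRing.scale /= mulr1].
  have dX : is_derive s (1 : R) (fun y : R => y ^+ 2) (2 * s).
    by apply: is_derive_eq; rewrite /GRing.scale /=; ring.
  have dV2 : is_derive s (1 : R) (fun y : R => (y ^+ 2)^-1) (- (s ^+ 2) ^- 2 * (2 * s)).
    have sn2 : s ^+ 2 != 0 by rewrite expf_neq0.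
    exact: (@is_deriveV _ (fun y : R => y ^+ 2) s (2 * s) 1 sn2 dX).
  have := is_deriveD (is_deriveM d1 dV) (is_deriveM d0 dV2).
  have -> : (derive1 w0 * (fun y => y^-1) + w0 * (fun y => (y ^+ 2)^-1))%R = G by [].
  move=> /is_derive_eq; apply; rewrite /g /g1 /g2 /GRing.scale /=.
  by field.
have G0 : G 3 - G 2^-1 = 0.
  have Z3 : derive1 w0 3 = 0 by apply: (w0_derive_out _).1; right; lra.
  have Zh : derive1 w0 2^-1 = 0 by apply: (w0_derive_out _).1; left; lra.
  rewrite /G Z3 Zh !mul0r !add0r.
  by rewrite /w0 !smooth_bump_out ?mul0r ?subrr//; lra.
have lt3 : 2^-1 < 3 :> R by lra.
have := @continuous_FTC2 R g G _ _ lt3.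
rewrite -EFinB G0 /Rintegral => ->//.
- apply: continuous_in_subspaceT => s; rewrite inE/= => sI.
  by apply: cvgB; [exact: cg1|apply: cvgM; [exact: cvg_cst|exact: cg2]].
- have contG (s : R) : 0 < s -> {for s, continuous G}.
    move=> s0; apply/differentiable_continuous/derivable1_diffP.
    exact: (@ex_derive _ _ _ _ _ _ _ (dG _ s0)).
  split.
  + move=> s sI; apply: (@ex_derive _ _ _ _ _ _ _ (dG s _)).
    by apply: pos; exact: subset_itv_oo_cc sI.
  + by apply: cvg_at_right_filter; apply: contG; rewrite invr_gt0.
  + by apply: cvg_at_left_filter; apply: contG.
- move=> s sI; rewrite derive1E; apply: (@derive_val _ _ _ _ _ _ _ (dG s _)).
  by apply: pos; exact: subset_itv_oo_cc sI.
Qed.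

Lemma expinv1_ge (y : R) : 4^-1 <= y -> expR (- 4) <= expinv 1 y.
Proof.
move=> y4; have y0 : 0 < y by rewrite (lt_le_trans _ y4)// invr_gt0.
by rewrite /expinv y0 hornerC mul1r ler_expR lerN2 invf_ple// posrE.
Qed.

Lemma w0_integral_gt0 : 0 < \int[mu]_(s in `[2^-1, 3]) (w0 s / s ^+ 3).
Proof.
(* On [5/4, 7/4] both ends of the support are at distance at least 1/4, so each factor of [w0] is at
   least exp(-4), while s^3 <= 2^3 = 8. *)
pose m : R := expR (- 4) ^+ 2 / 8.
have m0 : 0 < m by rewrite divr_gt0// exprn_gt0// expR_gt0.
have C0 : Cinf w0 by exact: Cinf_smooth_bump.
have sub : `[5 / 4, 7 / 4]%classic `<=` (`[2^-1, 3]%classic : set R).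
  by move=> s /=; rewrite !in_itv/= => /andP[s1 s2]; apply/andP; split; lra.
have E : `[5 / 4, 7 / 4]%classic = `[2^-1, 3]%classic `&` `[5 / 4, 7 / 4]%classic :> set R.
  by rewrite setIidr.
apply: (@lt_le_trans _ _ (\int[mu]_(s in `[5 / 4, 7 / 4]) m)).
  have muJ : fine (mu `[5 / 4, 7 / 4]) = 2^-1.
    by rewrite lebesgue_measure_itv/= lte_fin ifT/=; lra.
  by rewrite Rintegral_cst// muJ mulr_gt0// invr_gt0.
rewrite E Rintegral_mkcondr; apply: le_Rintegral => //.
- have := cst_integrable m (5 / 4) (7 / 4) true false.
  by rewrite {1}E -restrict_EFin => h; apply/integrable_restrict.
- exact: (quotient_integrable 3 (Cinf_continuous C0)).
move=> s /=; rewrite in_itv/= => /andP[s1 s2]; rewrite patchE.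
have s0 : 0 < s by rewrite (lt_le_trans _ s1)// invr_gt0.
case: ifPn => [|_]; last by rewrite divr_ge0 ?smooth_bump_ge0// exprn_ge0// ltW.
rewrite inE/= in_itv/= => /andP[s3 s4].
rewrite /m ler_pM ?exprn_ge0 ?expR_ge0 ?invr_ge0//.
  by rewrite expr2 ler_pM ?expR_ge0// expinv1_ge//; lra.
rewrite lef_pV2 ?posrE ?exprn_gt0//.
have -> : 8 = 2 ^+ 3 :> R by ring.
by rewrite lerXn2r ?nnegrE//; lra.
Qed.

Lemma pvq0 (f : R -> R) (s : R) : pvq f 0 s = (f (- s) - f s) / s.
Proof. by rewrite /pvq !add0r. Qed.

(** At x = 0 the folded quotient is (w''(-s) - w''(s)) / s. Its first term vanishes because the bump
    lives on the positive half-line, and the second integrates to minus twice a positive moment. *)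
Lemma Hil_w0_neq0 : Hil (derive1 (derive1 w0)) 0 != 0.
Proof.
suff -> : Hil (derive1 (derive1 w0)) 0 = - \int[mu]_(s in `[2^-1, 3]) (derive1 (derive1 w0) s / s).
  by rewrite w0_moment oppr_eq0 mulf_neq0// gt_eqF// w0_integral_gt0.
have C0 : Cc w0 by exact: Cc_smooth_bump.
have C2 := Cc_derive1 (Cc_derive1 C0).
have E : `[2^-1, 3]%classic = `]0, +oo[%classic `&` `[2^-1, 3]%classic :> set R.
  apply/seteqP; split => s /=; rewrite !in_itv/= ?andbT; last by case.
  by move=> /andP[h ->]; rewrite h (lt_le_trans _ h)// invr_gt0.
rewrite E Rintegral_mkcondr -mulN1r /Hil -RintegralZl//; last first.
  rewrite -restrict_EFin; apply/integrable_restrict => //; rewrite -E.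
  exact: (quotient_integrable 1 (Cc_continuous C2)).
apply: eq_Rintegral => s; rewrite inE/= in_itv/= andbT => s0.
have Z (y : R) (yo : y < 1 \/ 2 < y) : derive1 (derive1 w0) y = 0 := (w0_derive_out yo).2.
rewrite pvq0 Z; last by left; rewrite (@lt_trans _ _ 0)// oppr_lt0.
rewrite patchE; case: ifPn => [_|].
  by move: (derive1 _ _) => y; rewrite sub0r mulN1r mulNr.
rewrite notin_setE/= in_itv/= => /negP sI; rewrite Z.
  by rewrite subrr mul0r; exact/esym/mulr0.
by move: sI; rewrite negb_and -!ltNge => /orP[|]; [left|right]; lra.
Qed.

End Dipole.

(** * Weak derivatives in time *)

Section WeakTimeDerivative.
Context {R : realType}.
Notation mu := (@lebesgue_measure R).

(** The antiderivative from -oo of the bump on ]1, 2[, divided by its total mass, which is positive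
    by the mean value theorem. *)
Lemma smooth_step : exists B : R -> R, [/\ Cinf B, forall x, 0 <= derive1 B x,
  forall x, x <= 1 -> B x = 0 & forall x, 2 <= x -> B x = 1].
Proof.
pose be : R -> R := smooth_bump 1 2.
have Cbe : Cinf be by exact: Cinf_smooth_bump.
have cbe := Cinf_continuous Cbe.
have ibe (y : R) : mu.-integrable `]-oo, y] (EFin \o be).
  have -> : be = be \_ `[1, 2].
    apply/funext => x; rewrite patchE; case: ifPn => //.
    rewrite notin_setE/= in_itv/= => /negP; rewrite negb_and -!ltNge => xo.
    by apply: smooth_bump_out; apply/orP; case/orP: xo => /ltW; [left|right].
  rewrite -restrict_EFin; apply/integrable_restrict => //.
  apply: (@integrableS _ _ _ mu `[1, 2]) => //; first exact: measurableI.
  apply: continuous_compact_integrable; first exact: segment_compact.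
  exact: continuous_subspaceT.
pose B0 x := \int[mu]_(t in `]-oo, x]) be t.
have dB0 (x : R) : is_derive x (1 : R) B0 (be x).
  have x1 : x < x + 1 by rewrite ltrDl.
  have [d e] := @continuous_FTC1 R be -oo%O x (x + 1) x1 (ibe _) (ltNyr x) (cbe x).
  have e' : 'D_(1 : R) B0 x = be x by rewrite -derive1E; exact: e.
  exact: (@DeriveDef _ _ _ _ _ _ _ d e').
have B00 x : x <= 1 -> B0 x = 0.
  move=> x1; rewrite /B0 /Rintegral integral0_eq// => t; rewrite /= in_itv/= => tx.
  by rewrite /be smooth_bump_out// (le_trans tx).
have cB0 : continuous B0.
  move=> x; apply/differentiable_continuous/derivable1_diffP.
  exact: (@ex_derive _ _ _ _ _ _ _ (dB0 x)).
have B02 x : 2 <= x -> B0 x = B0 2.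
  move=> x2; apply/eqP; rewrite -subr_eq0.
  have [c] := @MVT_segment _ B0 be _ _ x2 (fun z _ => dB0 z) (continuous_subspaceT cB0).
  rewrite in_itv/= => /andP[c2 _] ->.
  by rewrite (_ : be c = 0) ?mul0r//; apply: smooth_bump_out; rewrite c2 orbT.
have I0 : 0 < B0 2.
  have lt12 : 1 < 2 :> R by rewrite ltr1n.
  have [c] := @MVT _ B0 be _ _ lt12 (fun z _ => dB0 z) (continuous_subspaceT cB0).
  rewrite in_itv/= => /andP[c1 c2]; rewrite (B00 1)// subr0 => ->.
  by rewrite mulr_gt0 ?subr_gt0//; exact: smooth_bump_gt0.
have dB (x : R) : is_derive x (1 : R) (fun x => (B0 2)^-1 * B0 x) ((B0 2)^-1 * be x).
  by apply: is_derive_eq.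
exists (fun x => (B0 2)^-1 * B0 x); split.
- by apply: (CinfS dB); apply: CinfM => //; exact: Cinf_cst.
- move=> x; rewrite derive1E (@derive_val _ _ _ _ _ _ _ (dB x)).
  by rewrite mulr_ge0 ?invr_ge0 ?(ltW I0)//; exact: smooth_bump_ge0.
- by move=> x /B00 ->; rewrite mulr0.
- by move=> x /B02 ->; rewrite mulVf// gt_eqF.
Qed.

Lemma nondecreasing_of_derive (f : R -> R) : Cinf f -> (forall x, 0 <= derive1 f x) ->
  {homo f : x y / x <= y}.
Proof.
move=> Cf f0 x y xy; rewrite -subr_ge0.
have [c _ ->] := @MVT_segment _ f (derive1 f) _ _ xy
  (fun z _ => Cinf_is_derive1 z Cf) (continuous_subspaceT (Cinf_continuous Cf)).
by rewrite mulr_ge0// subr_ge0.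
Qed.

Lemma Rintegral_oo_cc (a b : R) (f : R -> R) : mu.-integrable `[a, b] (EFin \o f) ->
  \int[mu]_(x in `]a, b[) f x = \int[mu]_(x in `[a, b]) f x.
Proof.
move=> i; rewrite Rintegral_itv_bndo_bndc ?Rintegral_itv_obnd_cbnd//.
  by apply: (integrableS _ _ _ i) => //; exact: subset_itv_oc_cc.
by apply: (integrableS _ _ _ i) => //; exact: subset_itv_oo_cc.
Qed.

Lemma Rintegral_derive1 (D : R -> R) (a b : R) : a < b -> Cinf D ->
  \int[mu]_(x in `[a, b]) derive1 D x = D b - D a.
Proof.
move=> ab CD; rewrite /Rintegral.
have cD := Cinf_continuous CD; have cD1 := Cinf_continuous (Cinf_derive1 CD).
rewrite (@continuous_FTC2 R (derive1 D) D a b ab (continuous_subspaceT cD1))//.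
split; first by move=> x _; exact: (@ex_derive _ _ _ _ _ _ _ (Cinf_is_derive1 x CD)).
  by apply: cvg_at_right_filter; exact: cD.
by apply: cvg_at_left_filter; exact: cD.
Qed.

(** [derive1 D] is a probability density on [0, T] concentrated on [p, q], and an average of values
    within eps of v stays within eps of v. *)
Lemma delta_estimate (T v eps p q : R) (a D : R -> R) : 0 < T -> Cinf D ->
  (forall t, 0 <= derive1 D t) -> (forall t, derive1 D t != 0 -> p <= t <= q) ->
  D T - D 0 = 1 -> {within `[0, T], continuous a} ->
  (forall t, 0 <= t <= T -> p <= t <= q -> `|a t - v| <= eps) ->
  `|\int[mu]_(t in `]0, T[) (derive1 D t * a t) - v| <= eps.
Proof.
move=> T0 CD D0 Dpq D1 ca av.
have cD1 := Cinf_continuous (Cinf_derive1 CD).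
have iC (f : R -> R) : {within `[0, T], continuous f} -> mu.-integrable `[0, T] (EFin \o f).
  by move=> cf; apply: continuous_compact_integrable => //; exact: segment_compact.
have cDa (f : R -> R) : {within `[0, T], continuous f} ->
    {within `[0, T], continuous (fun t => derive1 D t * f t)}.
  move=> cf x; apply: cvgM; last exact: cf.
  exact: (continuous_subspaceT cD1).
have ccst (k : R) : {within `[0, T], continuous (fun _ => k)}.
  by apply: continuous_subspaceT => x; exact: cvg_cst.
rewrite Rintegral_oo_cc; last exact/iC/cDa.
have Ek (k : R) : \int[mu]_(t in `[0, T]) (derive1 D t * k) = k.
  rewrite RintegralZr//; last exact/iC/(continuous_subspaceT cD1).
  by rewrite Rintegral_derive1// D1 mul1r.
rewrite -[X in _ - X](Ek v) -RintegralB//; [|exact/iC/cDa..].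
have cabs : {within `[0, T], continuous (fun t => derive1 D t * (a t - v))}.
  by apply: cDa => x; apply: cvgB; [exact: ca|exact: ccst].
have -> : \int[mu]_(x in `[0, T]) (derive1 D x * a x - derive1 D x * v) =
    \int[mu]_(x in `[0, T]) (derive1 D x * (a x - v)).
  by apply: eq_Rintegral => x _; rewrite mulrBr.
rewrite (le_trans (le_normr_Rintegral _ (iC _ cabs)))// -[leRHS](Ek eps).
apply: le_Rintegral => //; [exact: (integrable_norm (iC _ cabs))|exact/iC/cDa|].
move=> t /=; rewrite in_itv/= => tT; rewrite normrM ger0_norm//.
have [->|Dn0] := eqVneq (derive1 D t) 0; first by rewrite !mul0r.
by rewrite ler_wpM2l// av// Dpq.
Qed.

Lemma within_dist (T s eps : R) (a : R -> R) : {within `[0, T], continuous a} ->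
  0 <= s <= T -> 0 < eps -> exists2 del, 0 < del &
  forall t, 0 <= t <= T -> `|t - s| < del -> `|a t - a s| <= eps.
Proof.
move=> /subspace_continuousP ca sT e0.
have := ca s; rewrite /= in_itv/= sT => /(_ isT) /cvgrPdist_le /(_ _ e0).
rewrite near_withinE => -[del /= del0 H]; exists del => // t tT ts.
by rewrite distrC; apply: H; rewrite /= ?in_itv//= distrC.
Qed.

Definition time_test (T : R) (th : R -> R) := Cinf th /\
  exists c d, [/\ 0 < c, d < T & forall t, th t != 0 -> c <= t <= d].

Lemma derive1_lincomb (f : R -> R) (al c x : R) : Cinf f ->
  derive1 (fun x => f (al * x + c)) x = al * derive1 f (al * x + c).
Proof.
move=> Cf; rewrite derive1E; apply: derive_val; rewrite mulrC.
exact: (@is_derive1_comp _ f _ x _ _ (Cinf_is_derive1 _ Cf) (is_derive_affine al c x)).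
Qed.

Lemma derive1D (f g : R -> R) (x : R) : Cinf f -> Cinf g ->
  derive1 (fun x => f x + g x) x = derive1 f x + derive1 g x.
Proof.
move=> Cf Cg; rewrite derive1E; apply: derive_val.
exact: (is_deriveD (Cinf_is_derive1 x Cf) (Cinf_is_derive1 x Cg)).
Qed.

Lemma derive1cZ (f : R -> R) (k x : R) : Cinf f ->
  derive1 (fun x => k * f x) x = k * derive1 f x.
Proof.
move=> Cf; rewrite derive1E; apply: derive_val.
exact: (is_deriveZ k (Cinf_is_derive1 x Cf)).
Qed.

(** Test with smooth cutoffs that tend to the indicator of ]s1, s2[: their derivative is a unit mass
    just after s1 minus a unit mass just before s2. Both transitions take place strictly inside ]s1,
    s2[, so s1 = 0 and s2 = T are covered. *)
Lemma weak_derivative (T : R) (a b : R -> R) : 0 < T ->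
  {within `[0, T], continuous a} -> {within `[0, T], continuous b} ->
  (forall th, time_test T th ->
     \int[mu]_(t in `]0, T[) (derive1 th t * a t + th t * b t) = 0) ->
  forall s1 s2, 0 <= s1 -> s1 < s2 -> s2 <= T ->
    a s2 - a s1 = \int[mu]_(t in `]s1, s2[) b t.
Proof.
move=> T0 ca cb H s1 s2 s10 s12 s2T.
have [B [CB B'0 B1 B2]] := smooth_step.
have B01 x : 0 <= B x <= 1.
  have mB := nondecreasing_of_derive CB B'0.
  apply/andP; split.
    by have [x1|/ltW x1] := leP x 1; [rewrite B1|rewrite -(B1 1)// mB].
  by have [x1|/ltW x1] := leP 2 x; [rewrite B2|rewrite -(B2 2)// mB].
(* The rise occupies the times s1 + [1/k, 2/k] and the fall s2 - [1/k, 2/k]. Since k (s2 - s1) >= 4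
   = 2 + 2, they do not overlap, and 1/k tends to 0. *)
pose k n : R := (4 + n%:R) / (s2 - s1).
have ks n : 4 + n%:R = k n * (s2 - s1) by rewrite /k mulfVK// subr_eq0 gt_eqF.
have k0 n : 0 < k n by rewrite divr_gt0 ?subr_gt0// ltr_wpDr.
pose D1 n t := B (k n * t + - (k n * s1)).
pose E2 n t := B (- k n * t + k n * s2).
pose D2 n t := - 1 * E2 n t.
have CD1 n : Cinf (D1 n) by exact: Cinf_lincomb.
have CE2 n : Cinf (E2 n) by exact: Cinf_lincomb.
have CD2 n : Cinf (D2 n) by apply: CinfM => //; exact: Cinf_cst.
have dD1 n t : derive1 (D1 n) t = k n * derive1 B (k n * t + - (k n * s1)).
  exact: derive1_lincomb.
have dE2 n t : derive1 (E2 n) t = - k n * derive1 B (- k n * t + k n * s2).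
  exact: derive1_lincomb.
have dD2 n t : derive1 (D2 n) t = k n * derive1 B (- k n * t + k n * s2).
  by rewrite derive1cZ// dE2; ring.
have B'z x : derive1 B x != 0 -> 1 <= x <= 2.
  apply: contra_neqT; rewrite negb_and -!ltNge => /orP[x1|x2].
    apply: (@derive1_locally_cst _ _ 0); near=> y; apply: B1; apply: ltW.
    by near: y; exact: lt_nbhsl.
  apply: (@derive1_locally_cst _ _ 1); near=> y; apply: B2; apply: ltW.
  by near: y; exact: lt_nbhsr.
have kV n x : (1 <= k n * x) = ((k n)^-1 <= x) by rewrite -ler_pdivrMl// mulr1.
have kV2 n x : (k n * x <= 2) = (x <= 2 * (k n)^-1) by rewrite -ler_pdivlMl// mulrC.
have kV2' n x : (2 <= k n * x) = (2 * (k n)^-1 <= x) by rewrite -ler_pdivrMl// mulrC.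
have X1 n t : k n * t + - (k n * s1) = k n * (t - s1) by ring.
have X2 n t : - k n * t + k n * s2 = k n * (s2 - t) by ring.
(* [D1] rises from 0 to 1 near s1 and [E2] falls from 1 to 0 near s2. One of them is always 1, so
   subtracting 1 leaves a cutoff that vanishes on both sides. [D2] is [E2] with the sign changed, so
   that its derivative is a positive unit mass too. *)
pose th n t := D1 n t + E2 n t + - 1.
have Cth n : Cinf (th n).
  by move=> m; apply: CnD; [apply: CnD; [exact: CD1|exact: CE2]|exact: Cn_cst].
have dth n t : derive1 (th n) t = derive1 (D1 n) t - derive1 (D2 n) t.
  have C12 : Cinf (fun t => D1 n t + E2 n t) by move=> m; apply: CnD; [exact: CD1|exact: CE2].
  rewrite derive1D//; last exact: Cinf_cst.
  rewrite derive1D// dE2 dD2 (@derive1_locally_cst _ (fun=> - 1) (- 1)); first ring.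
  by near=> y.
have th0 n t : th n t != 0 -> s1 + (k n)^-1 <= t <= s2 - (k n)^-1.
  have kk : 4 <= k n * (t - s1) + k n * (s2 - t).
    have -> : k n * (t - s1) + k n * (s2 - t) = k n * (s2 - s1) by ring.
    by rewrite -ks lerDl.
  rewrite /th /D1 /E2 X1 X2 => t0; apply/andP; split.
    rewrite -lerBrDl -kV leNgt; apply: contra_neqN t0 => /ltW x1.
    by rewrite B1// B2; [ring|lra].
  rewrite lerBrDr -lerBrDl -kV leNgt; apply: contra_neqN t0 => /ltW x1.
  by rewrite (B1 (k n * (s2 - t)))// B2; [ring|lra].
have tth n : time_test T (th n).
  split; first exact: Cth.
  exists (s1 + (k n)^-1), (s2 - (k n)^-1); split; last exact: th0.
    by rewrite ltr_wpDl// invr_gt0.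
  by rewrite (lt_le_trans _ s2T)// gtrBl invr_gt0.
have iC (f : R -> R) : {within `[0, T], continuous f} -> mu.-integrable `]0, T[ (EFin \o f).
  move=> cf; apply: (@integrableS _ _ _ mu `[0, T]) => //; first exact: subset_itv_oo_cc.
  by apply: continuous_compact_integrable => //; exact: segment_compact.
have cM (f g : R -> R) : Cinf f -> {within `[0, T], continuous g} ->
    {within `[0, T], continuous (fun t => f t * g t)}.
  move=> Cf cg x; apply: cvgM; last exact: cg.
  exact: (continuous_subspaceT (Cinf_continuous Cf)).
have iD1 n := iC _ (cM _ _ (Cinf_derive1 (CD1 n)) ca).
have iD2 n := iC _ (cM _ _ (Cinf_derive1 (CD2 n)) ca).
have ith n := iC _ (cM _ _ (Cth n) cb).
have key n : \int[mu]_(t in `]0, T[) (derive1 (D1 n) t * a t) -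
    \int[mu]_(t in `]0, T[) (derive1 (D2 n) t * a t) +
    \int[mu]_(t in `]0, T[) (th n t * b t) = 0.
  rewrite -RintegralB//; have i12 : mu.-integrable `]0, T[
      (EFin \o (fun t => derive1 (D1 n) t * a t - derive1 (D2 n) t * a t)).
    by apply: (integrableB _ (iD1 n) (iD2 n)).
  rewrite -[RHS](H _ (tth n)) -RintegralD//.
  by apply: eq_Rintegral => t _; congr (_ + _); rewrite (dth n t) mulrBl.
have kcvg : (k n)^-1 @[n --> \oo] --> 0.
  have -> : (fun n => (k n)^-1) = (fun n => (s2 - s1) * (4 + n%:R)^-1).
    by apply/funext => n; rewrite /k invf_div.
  rewrite -(mulr0 (s2 - s1)); apply: cvgMr; apply/gtr0_cvgV0; first exact: nearW.
  apply/cvgryPge => A; near=> n; rewrite (@le_trans _ _ n%:R) ?lerDr//.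
  by near: n; exact: nbhs_infty_ger.
have l1 : \int[mu]_(t in `]0, T[) (derive1 (D1 n) t * a t) @[n --> \oo] --> a s1.
  apply/cvgrPdist_le => e e0.
  have [|del del0 Hdel] := within_dist ca (s := s1) _ e0; first by apply/andP; split; lra.
  near=> n; rewrite distrC.
  apply: (delta_estimate (p := s1 + (k n)^-1) (q := s1 + 2 * (k n)^-1)) => //.
  - by move=> t; rewrite dD1 mulr_ge0// ltW.
  - move=> t; rewrite dD1 X1 mulf_eq0 gt_eqF//= => /B'z; rewrite kV kV2 => /andP[h1 h2].
    by apply/andP; split; lra.
  - have sT : s1 <= T by lra.
    rewrite /D1 !X1 (B1 (k n * (0 - s1))); last by rewrite (@le_trans _ _ 0)// mulr_ge0_le0 ?(ltW (k0 n))//; lra.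
    have hk : 2 <= k n * (s2 - s1) by rewrite -ks (@le_trans _ _ 4) ?ler_nat// lerDl.
    have hT : k n * (s2 - s1) <= k n * (T - s1) by rewrite ler_wpM2l ?(ltW (k0 n))//; lra.
    by rewrite B2 ?subr0//; lra.
  move=> t tT /andP[t1 t2]; apply: Hdel => //.
  have kd : (k n)^-1 < del / 2 by near: n; apply: (cvgr_lt _ kcvg); rewrite divr_gt0.
  have kn0 : 0 < (k n)^-1 by rewrite invr_gt0.
  by rewrite ltr_norml; apply/andP; split; lra.
have l2 : \int[mu]_(t in `]0, T[) (derive1 (D2 n) t * a t) @[n --> \oo] --> a s2.
  apply/cvgrPdist_le => e e0.
  have [|del del0 Hdel] := within_dist ca (s := s2) _ e0; first by apply/andP; split; lra.
  near=> n; rewrite distrC.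
  apply: (delta_estimate (p := s2 - 2 * (k n)^-1) (q := s2 - (k n)^-1)) => //.
  - by move=> t; rewrite dD2 mulr_ge0// ltW.
  - move=> t; rewrite dD2 X2 mulf_eq0 gt_eqF//= => /B'z; rewrite kV kV2 => /andP[h1 h2].
    by apply/andP; split; lra.
  - rewrite /D2 /E2 !X2 (B1 (k n * (s2 - T))); last by rewrite (@le_trans _ _ 0)// mulr_ge0_le0 ?(ltW (k0 n))//; lra.
    have hk : 2 <= k n * (s2 - s1) by rewrite -ks (@le_trans _ _ 4) ?ler_nat// lerDl.
    have hT : k n * (s2 - s1) <= k n * (s2 - 0) by rewrite ler_wpM2l ?(ltW (k0 n))//; lra.
    by rewrite B2; [ring|lra].
  move=> t tT /andP[t1 t2]; apply: Hdel => //.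
  have kd : (k n)^-1 < del / 2 by near: n; apply: (cvgr_lt _ kcvg); rewrite divr_gt0.
  have kn0 : 0 < (k n)^-1 by rewrite invr_gt0.
  by rewrite ltr_norml; apply/andP; split; lra.
have l3 : \int[mu]_(t in `]0, T[) (th n t * b t) @[n --> \oo] --> \int[mu]_(t in `]s1, s2[) b t.
  have E : `]s1, s2[%classic = `]0, T[%classic `&` `]s1, s2[%classic :> set R.
    apply/seteqP; split => s /=; rewrite !in_itv/=; last by case.
    by move=> /andP[h1 h2]; split; apply/andP; split; lra.
  rewrite E Rintegral_mkcondr; apply: (@Rdominated_convergence _ (measurableTypeR R) R mu _
    (fun n t => th n t * b t) _ (fun t => `|b t|)) => //.
  - by move=> n; apply/measurable_EFinP; exact: (measurable_int _ (ith n)).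
  - move=> t; rewrite /= in_itv/= => /andP[t0 tT]; rewrite patchE; case: ifPn.
      rewrite inE/= in_itv/= => /andP[h1 h2]; apply: cvg_near_cst; near=> n.
      rewrite /th /D1 /E2 X1 X2 !B2; first by ring.
        rewrite kV2'; have : (k n)^-1 < (s2 - t) / 2; last lra.
        by near: n; apply: (cvgr_lt _ kcvg); rewrite divr_gt0 ?subr_gt0.
      rewrite kV2'; have : (k n)^-1 < (t - s1) / 2; last lra.
      by near: n; apply: (cvgr_lt _ kcvg); rewrite divr_gt0 ?subr_gt0.
    rewrite notin_setE/= in_itv/= => /negP tout; apply: cvg_near_cst; apply: nearW => n.
    suff -> : th n t = 0 by rewrite mul0r.
    apply/eqP/negPn/negP => /th0 /andP[h1 h2]; move/negP: tout; apply.
    have kn0 : 0 < (k n)^-1 by rewrite invr_gt0.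
    by apply/andP; split; lra.
  - exact: (integrable_norm (iC _ cb)).
  - move=> n t _; rewrite normrM ler_piMl//.
    have /andP[h1 h2] := B01 (k n * t + - (k n * s1)).
    have /andP[h3 h4] := B01 (- k n * t + k n * s2).
    by rewrite /th /D1 /E2 ler_norml; apply/andP; split; lra.
have L : (fun n => \int[mu]_(t in `]0, T[) (derive1 (D1 n) t * a t) -
    \int[mu]_(t in `]0, T[) (derive1 (D2 n) t * a t) +
    \int[mu]_(t in `]0, T[) (th n t * b t)) @ \oo -->
    a s1 - a s2 + \int[mu]_(t in `]s1, s2[) b t.
  exact: (cvgD (cvgB l1 l2) l3).
rewrite (funext key) in L.
have L0 := cvg_unique (@Rhausdorff R) L (cvg_cst 0).
move: L0; set J := Rintegral _ _ _ => L0.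
by apply/eqP; rewrite eq_sym -subr_eq0 opprB addrC L0.
Unshelve. all: by end_near. Qed.

End WeakTimeDerivative.

(** * Pairings with weighted L^2 functions *)

Section Plane.
Context {R : realType}.
Notation mu := (@lebesgue_measure R).
Notation mu2 := ((@lebesgue_measure R) \x (@lebesgue_measure R))%E.
Implicit Types (f k rho : plane R -> R).

(** The integrable majorant of all linear pairings. Its product form reduces integrability to that
    of 1/(1 + x^2) on the line. *)
Definition cauchy2 (p : plane R) : R := (1 + p.1 ^+ 2)^-1 * (1 + p.2 ^+ 2)^-1.

Lemma oneDsq_gt0 (x : R) : 0 < 1 + x ^+ 2.
Proof. by rewrite ltr_wpDr// sqr_ge0. Qed.

Lemma measurable_fun1 (h : R -> R) : continuous h ->
  measurable_fun setT (fun p : plane R => h p.1).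
Proof.
move=> ch; apply: (@measurableT_comp _ _ _ _ _ _ h); last exact: measurable_fst.
exact: continuous_measurable_fun.
Qed.

Lemma measurable_fun2 (h : R -> R) : continuous h ->
  measurable_fun setT (fun p : plane R => h p.2).
Proof.
move=> ch; apply: (@measurableT_comp _ _ _ _ _ _ h); last exact: measurable_snd.
exact: continuous_measurable_fun.
Qed.

Lemma oneDsqV_integral : exists2 c : R, 0 <= c &
  (\int[mu]_x ((1 + x ^+ 2)^-1)%:E = c%:E)%E.
Proof.
exists (2 * (pi / 2)); first by rewrite !mulr_ge0// ?invr_ge0// pi_ge0.
have := @ge0_symfun_integralT R (fun x => (oneDsqr x)^-1).
rewrite /oneDsqr => ->.
- rewrite EFinM -integral0y_oneDsqr; congr (_ * _)%E.
  by rewrite set_itvcy.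
- by move=> x; rewrite invr_ge0 ltW// oneDsq_gt0.
- exact: continuous_oneDsqrV.
- by move=> x /=; rewrite sqrrN.
Qed.

Lemma cauchy2_ge0 p : 0 <= cauchy2 p.
Proof. by rewrite mulr_ge0// invr_ge0 ltW// oneDsq_gt0. Qed.

Lemma measurable_cauchy2 : measurable_fun setT cauchy2.
Proof.
by apply: measurable_funM; [apply: (@measurable_fun1 (fun x => (oneDsqr x)^-1))|
  apply: (@measurable_fun2 (fun x => (oneDsqr x)^-1))]; exact: continuous_oneDsqrV.
Qed.

Lemma cauchy2_integrable : mu2.-integrable setT (EFin \o cauchy2).
Proof.
apply/integrable12ltyP; first by apply/measurable_EFinP; exact: measurable_cauchy2.
have [c c0 Hc] := oneDsqV_integral.
have mV : measurable_fun setT (fun x : measurableTypeR R => ((1 + x ^+ 2)^-1)%:E).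
  by apply/measurable_EFinP; apply: continuous_measurable_fun; exact: continuous_oneDsqrV.
have E x : (\int[mu]_y `|(EFin \o cauchy2) (x, y)| = ((1 + x ^+ 2)^-1 * c)%:E)%E.
  rewrite EFinM -Hc -ge0_integralZl//.
  - by apply: eq_integral => y _; rewrite /= ger0_norm ?cauchy2_ge0// EFinM.
  - by move=> y _; rewrite lee_fin invr_ge0 ltW// oneDsq_gt0.
  - by rewrite lee_fin invr_ge0 ltW// oneDsq_gt0.
under eq_integral do rewrite E EFinM muleC.
rewrite ge0_integralZl ?Hc -?EFinM ?ltry//.
by move=> y _; rewrite lee_fin invr_ge0 ltW// oneDsq_gt0.
Qed.

Lemma bracket_ge (p : plane R) :
  [/\ 1 <= bracket p, 1 + p.1 ^+ 2 <= bracket p & 1 + p.2 ^+ 2 <= bracket p].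
Proof.
have [h1 h2] := (sqr_ge0 p.1, sqr_ge0 p.2).
by rewrite /bracket; split; lra.
Qed.

Lemma bracket_gt0 (p : plane R) : 0 < bracket p.
Proof. by have [h _ _] := bracket_ge p; rewrite (lt_le_trans _ h). Qed.

Lemma measurable_bracket : measurable_fun setT (@bracket R).
Proof.
by apply: measurable_funD; [apply: measurable_funD => //|];
  apply: measurable_funX; [exact: measurable_fst|exact: measurable_snd].
Qed.

(* The density of the squared norm in L^2((1 + x^2 + y^2)^2 dx dy). *)
Definition dens f (p : plane R) : R := bracket p ^+ 2 * f p ^+ 2.

Lemma dens_ge0 f p : 0 <= dens f p.
Proof. by rewrite mulr_ge0// ?sqr_ge0. Qed.

Definition wgt2 f : Prop := measurable_fun setT f /\ mu2.-integrable setT (EFin \o dens f).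

Lemma measurable_dens f : measurable_fun setT f -> measurable_fun setT (dens f).
Proof.
move=> mf; apply: measurable_funM; apply: measurable_funX => //.
exact: measurable_bracket.
Qed.

Lemma weighted_normsq_dens f : weighted_normsq 2 f = (\int[mu2]_p (dens f p)%:E)%E.
Proof.
by apply: eq_integral => p _; rewrite powR_mulrn// ltW// bracket_gt0.
Qed.

Lemma in_weighted_wgt2 f : in_weighted 2 f -> wgt2 f.
Proof.
move=> [mf]; rewrite weighted_normsq_dens => fin; split => //.
apply/integrableP; split; first by apply/measurable_EFinP; exact: measurable_dens.
by under eq_integral do rewrite /= ger0_norm ?dens_ge0//.
Qed.

(* Exactly the growth for which [k p ^+ 2 / bracket p ^+ 2] is dominated by the
   integrable [cauchy2]; it allows k = O(1), and k = O(1 + |x|) if k decays in y. *)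
Definition admissible k (C : R) : Prop := [/\ measurable_fun setT k, 0 <= C &
  forall p, k p ^+ 2 * ((1 + p.1 ^+ 2) * (1 + p.2 ^+ 2)) <= C * bracket p ^+ 2].

Lemma admissible_sq k C p : admissible k C -> k p ^+ 2 / bracket p ^+ 2 <= C * cauchy2 p.
Proof.
move=> [_ C0 /(_ p) H].
have xy0 : 0 < (1 + p.1 ^+ 2) * (1 + p.2 ^+ 2) by rewrite mulr_gt0// oneDsq_gt0.
by rewrite /cauchy2 -invfM ler_pdivlMr// mulrAC ler_pdivrMr ?exprn_gt0 ?bracket_gt0.
Qed.

(** Cauchy-Schwarz in pointwise form: split f k as (bracket |f|) (|k| / bracket) and apply the
    arithmetic-geometric inequality with parameter e. The same bound serves as a dominating function
    (e = 1) and as a small estimate (e tuned). *)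
Lemma pairing_amgm k C f p e : admissible k C -> 0 < e ->
  `|f p * k p| <= e^-1 * dens f p + e * (C * cauchy2 p).
Proof.
move=> adk e0; have b0 := bracket_gt0 p.
apply: (@le_trans _ _ (e^-1 * dens f p + e * (k p ^+ 2 / bracket p ^+ 2))); last first.
  by rewrite lerD2l ler_wpM2l ?(ltW e0)//; exact: admissible_sq.
pose A := bracket p * `|f p|; pose B := `|k p| / bracket p.
have -> : `|f p * k p| = A * B by rewrite /A /B normrM; field; rewrite gt_eqF.
have -> : dens f p = A ^+ 2 by rewrite /A /dens exprMn real_normK// num_real.
have -> : k p ^+ 2 / bracket p ^+ 2 = B ^+ 2.
  by rewrite /B exprMn real_normK ?num_real// exprVn.
have [A0 B0] : 0 <= A /\ 0 <= B by rewrite !mulr_ge0 ?invr_ge0// ltW.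
have h : A * B *+ 2 <= e^-1 * A ^+ 2 + e * B ^+ 2.
  rewrite -subr_ge0.
  have -> : e^-1 * A ^+ 2 + e * B ^+ 2 - A * B *+ 2 = e^-1 * (A - e * B) ^+ 2.
    by field; rewrite gt_eqF.
  by rewrite mulr_ge0 ?sqr_ge0// invr_ge0 ltW.
by rewrite (le_trans _ h)// mulr2n lerDl mulr_ge0.
Qed.

Lemma pairing_dom_integrable f C e : wgt2 f ->
  mu2.-integrable setT (EFin \o (fun p => e^-1 * dens f p + e * (C * cauchy2 p))).
Proof.
move=> [_ If].
have := integrableD measurableT (integrableZl measurableT e^-1 If)
  (integrableZl measurableT (e * C) cauchy2_integrable).
by apply: eq_integrable => // p _; rewrite /= -!EFinM -EFinD (mulrA e C).
Qed.

Lemma pairing_integrable f k C : wgt2 f -> admissible k C ->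
  mu2.-integrable setT (EFin \o (fun p => f p * k p)).
Proof.
move=> wf adk; apply: (dominated_Rintegrable _ _ (pairing_dom_integrable C 1 wf)) => //.
  by apply: measurable_funM; [exact: wf.1|case: adk].
by move=> p _; exact: pairing_amgm.
Qed.

Lemma Rintegral_lin2 (f1 f2 : plane R -> R) (a1 a2 : R) :
  mu2.-integrable setT (EFin \o f1) -> mu2.-integrable setT (EFin \o f2) ->
  \int[mu2]_p (a1 * f1 p + a2 * f2 p) = a1 * \int[mu2]_p f1 p + a2 * \int[mu2]_p f2 p.
Proof.
move=> I1 I2; rewrite RintegralD//=; [|exact: (integrableZl measurableT a1 I1)|
  exact: (integrableZl measurableT a2 I2)].
by rewrite !RintegralZl.
Qed.

Lemma pairing_bound f k C e : wgt2 f -> admissible k C -> 0 < e ->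
  `|\int[mu2]_p (f p * k p)| <=
    e^-1 * \int[mu2]_p dens f p + e * (C * \int[mu2]_p cauchy2 p).
Proof.
move=> wf adk e0; have I := pairing_integrable wf adk.
rewrite (le_trans (le_normr_Rintegral measurableT I))//.
rewrite mulrA -Rintegral_lin2//; [|exact: wf.2|exact: cauchy2_integrable].
apply: le_Rintegral => //; first exact: (integrable_norm I).
  by under eq_fun do rewrite -mulrA; exact: pairing_dom_integrable.
by move=> p _; rewrite -mulrA; exact: pairing_amgm.
Qed.

Lemma pairing_cvg f (k_ : nat -> plane R -> R) k C : wgt2 f ->
  (forall n, admissible (k_ n) C) -> (forall p, k_ n p @[n --> \oo] --> k p) ->
  \int[mu2]_p (f p * k_ n p) @[n --> \oo] --> \int[mu2]_p (f p * k p).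
Proof.
move=> wf adk kk; apply: (Rdominated_convergence _ _ _ (pairing_dom_integrable C 1 wf)) => //.
- by move=> n; apply: measurable_funM; [exact: wf.1|case: (adk n)].
- by move=> p _; apply: cvgM; [exact: cvg_cst|exact: kk].
- by move=> n p _; exact: pairing_amgm.
Qed.

(** The largest growth that the weight absorbs for f^2: the product is then at most C times
    [dens f]. *)
Definition quad_admissible rho (C : R) : Prop := [/\ measurable_fun setT rho, 0 <= C &
  forall p, `|rho p| <= C * bracket p ^+ 2].

Lemma quad_dom rho C f p : quad_admissible rho C -> `|f p ^+ 2 * rho p| <= C * dens f p.
Proof.
move=> [_ C0 H]; rewrite normrM ger0_norm ?sqr_ge0// /dens.
have -> : C * (bracket p ^+ 2 * f p ^+ 2) = f p ^+ 2 * (C * bracket p ^+ 2) by ring.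
by rewrite ler_wpM2l ?sqr_ge0.
Qed.

Lemma quad_integrable f rho C : wgt2 f -> quad_admissible rho C ->
  mu2.-integrable setT (EFin \o (fun p => f p ^+ 2 * rho p)).
Proof.
move=> [mf If] adr; apply: (dominated_Rintegrable (g := fun p => C * dens f p)) => //.
- by apply: measurable_funM; [exact: measurable_funX|case: adr].
- exact: (integrableZl measurableT C If).
- by move=> p _; exact: quad_dom.
Qed.

Lemma quad_bound f rho C : wgt2 f -> quad_admissible rho C ->
  `|\int[mu2]_p (f p ^+ 2 * rho p)| <= C * \int[mu2]_p dens f p.
Proof.
move=> wf adr; have I := quad_integrable wf adr.
rewrite (le_trans (le_normr_Rintegral measurableT I))// -RintegralZl//; last exact: wf.2.
apply: le_Rintegral => //; first exact: (integrable_norm I).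
  exact: (integrableZl measurableT C wf.2).
by move=> p _; exact: quad_dom.
Qed.

Lemma quad_cvg f (rho_ : nat -> plane R -> R) rho C : wgt2 f ->
  (forall n, quad_admissible (rho_ n) C) -> (forall p, rho_ n p @[n --> \oo] --> rho p) ->
  \int[mu2]_p (f p ^+ 2 * rho_ n p) @[n --> \oo] --> \int[mu2]_p (f p ^+ 2 * rho p).
Proof.
move=> wf adr rr; apply: (Rdominated_convergence (g := fun p => C * dens f p)) => //.
- by move=> n; apply: measurable_funM; [exact: measurable_funX wf.1|case: (adr n)].
- by move=> p _; apply: cvgM; [exact: cvg_cst|exact: rr].
- exact: (integrableZl measurableT C wf.2).
- by move=> n p _; exact: quad_dom.
Qed.

Lemma wgt2B f1 f2 : wgt2 f1 -> wgt2 f2 -> wgt2 (fun p => f1 p - f2 p).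
Proof.
move=> [m1 I1] [m2 I2]; have mB := measurable_funB m1 m2; split => //.
apply: (dominated_Rintegrable (g := fun p => 2 * dens f1 p + 2 * dens f2 p)) => //.
- exact: measurable_dens.
- exact: (integrableD measurableT (integrableZl measurableT 2 I1) (integrableZl measurableT 2 I2)).
move=> p _; rewrite ger0_norm ?dens_ge0// /dens.
have -> : 2 * (bracket p ^+ 2 * f1 p ^+ 2) + 2 * (bracket p ^+ 2 * f2 p ^+ 2) =
  bracket p ^+ 2 * (2 * f1 p ^+ 2 + 2 * f2 p ^+ 2) by ring.
rewrite ler_wpM2l ?sqr_ge0//.
rewrite -subr_ge0.
have -> : 2 * f1 p ^+ 2 + 2 * f2 p ^+ 2 - (f1 p - f2 p) ^+ 2 = (f1 p + f2 p) ^+ 2 by ring.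
exact: sqr_ge0.
Qed.

(** With d = f1 - f2, f1^2 - f2^2 = d^2 + 2 d f2, and the cross term is split with parameter e. Only
    the norm of f2 enters besides that of d, so that f2 can be the value at the fixed time where
    continuity is proved. *)
Lemma quad_diff f1 f2 rho C e : wgt2 f1 -> wgt2 f2 -> quad_admissible rho C -> 0 < e ->
  `|\int[mu2]_p (f1 p ^+ 2 * rho p) - \int[mu2]_p (f2 p ^+ 2 * rho p)| <=
  C * (1 + e^-1) * \int[mu2]_p dens (fun p => f1 p - f2 p) p + C * e * \int[mu2]_p dens f2 p.
Proof.
move=> w1 w2 adr e0; have [I1 I2] := (quad_integrable w1 adr, quad_integrable w2 adr).
have wB := wgt2B w1 w2.
rewrite -RintegralB// -Rintegral_lin2//; [|exact: wB.2|exact: w2.2].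
have I12 := integrableB measurableT I1 I2.
rewrite (le_trans (le_normr_Rintegral measurableT I12))//.
apply: le_Rintegral => //; first exact: (integrable_norm I12).
  exact: (integrableD measurableT (integrableZl measurableT (C * (1 + e^-1)) wB.2)
    (integrableZl measurableT (C * e) w2.2)).
move=> p _; case: adr => _ C0 /(_ p) H; rewrite -mulrBl normrM.
pose d := f1 p - f2 p.
have h : `|f1 p ^+ 2 - f2 p ^+ 2| <= (1 + e^-1) * d ^+ 2 + e * f2 p ^+ 2.
  have -> : f1 p ^+ 2 - f2 p ^+ 2 = d ^+ 2 + 2 * d * f2 p by rewrite /d; ring.
  have h1 : 0 <= e^-1 * (d - e * f2 p) ^+ 2 by rewrite mulr_ge0 ?sqr_ge0// invr_ge0 ltW.
  have h2 : 0 <= e^-1 * (d + e * f2 p) ^+ 2 by rewrite mulr_ge0 ?sqr_ge0// invr_ge0 ltW.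
  have e1 : e^-1 * (d - e * f2 p) ^+ 2 = e^-1 * d ^+ 2 + e * f2 p ^+ 2 - 2 * d * f2 p.
    by field; rewrite gt_eqF.
  have e2 : e^-1 * (d + e * f2 p) ^+ 2 = e^-1 * d ^+ 2 + e * f2 p ^+ 2 + 2 * d * f2 p.
    by field; rewrite gt_eqF.
  have d20 := sqr_ge0 d.
  rewrite e1 in h1; rewrite e2 in h2; rewrite ler_norml mulrDl mul1r.
  by apply/andP; split; lra.
rewrite (le_trans (ler_pM _ _ h H))// /dens -/d.
by rewrite le_eqVlt; apply/orP; left; apply/eqP; ring.
Qed.

End Plane.

(** * Continuity in time of linear and quadratic pairings *)

Section Flow.
Context {R : realType}.
Notation mu2 := ((@lebesgue_measure R) \x (@lebesgue_measure R))%E.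
Variables (T : R) (u : R -> plane R -> R).
Hypothesis u_cont : continuous_in_Z 4 2 T u.

Lemma sobolev_normsq_ge0 (s : R) (f : plane R -> R) : (0 <= sobolev_normsq s f)%E.
Proof.
apply: le_ereal_inf_tmp => _ [g _ <-]; apply: integral_ge0 => q _.
by rewrite lee_fin mulr_ge0 ?powR_ge0// addr_ge0// sqr_ge0.
Qed.

Lemma u_wgt2 t : t \in `[0, T] -> wgt2 (u t).
Proof. by move=> /u_cont.1 [_]; exact: in_weighted_wgt2. Qed.

(** The Sobolev part of the norm is nonnegative, so the weighted part is squeezed between 0 and the
    whole. *)
Lemma u_dens_near t0 e : t0 \in `[0, T] -> 0 < e ->
  \forall t \near within `[0, T] (nbhs t0),
    \int[mu2]_p dens (fun p => u t p - u t0 p) p <= e.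
Proof.
move=> t0T e0; have := u_cont.2 _ t0T.
move=> Z0.
have W0 : (fun t => weighted_normsq 2 (fun p => u t p - u t0 p))
    @ within `[0, T] (nbhs t0) --> 0%E.
  apply: (squeeze_cvge _ (cvg_cst 0%E) Z0); apply: nearW => t; apply/andP; split.
    by apply: integral_ge0 => p _; rewrite lee_fin mulr_ge0 ?powR_ge0 ?sqr_ge0.
  by rewrite leeDr// sobolev_normsq_ge0.
have /fine_cvgP[_ /cvgr_le] := W0; move=> /(_ _ e0); apply: filterS => t.
by rewrite /= weighted_normsq_dens.
Qed.

Lemma pairing_continuous k C : admissible k C ->
  {within `[0, T], continuous (fun t => \int[mu2]_p (u t p * k p))}.
Proof.
move=> adk; apply/subspace_continuousP => t0 t0T; apply/cvgrPdist_le => e e0.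
have t0T' : t0 \in `[0, T] by [].
pose c2 := C * \int[mu2]_p cauchy2 p.
have c20 : 0 <= c2.
  by rewrite mulr_ge0//; [case: adk|apply: Rintegral_ge0 => p _; exact: cauchy2_ge0].
(* The parameter for [pairing_bound]: del c2 <= e / 2. The times are then restricted so that the
   squared distance is at most del e / 2, which makes the other term at most e / 2. The + 1 avoids
   dividing by 0. *)
pose del := e / 2 / (c2 + 1).
have c21 : 0 < c2 + 1 by rewrite ltr_wpDl.
have del0 : 0 < del by rewrite !divr_gt0.
have ed0 : 0 < del * (e / 2) by rewrite mulr_gt0// divr_gt0.
have H := u_dens_near t0T' ed0.
near=> t.
have tT : t \in `[0, T] by near: t; rewrite near_withinE; exact: nearW.
have Ht : \int[mu2]_p dens (fun p => u t p - u t0 p) p <= del * (e / 2) by near: t.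
rewrite distrC -RintegralB//; [|exact: (pairing_integrable (u_wgt2 tT) adk)|
  exact: (pairing_integrable (u_wgt2 t0T') adk)].
have -> : \int[mu2]_p (u t p * k p - u t0 p * k p) =
    \int[mu2]_p ((fun p => u t p - u t0 p) p * k p).
  by apply: eq_Rintegral => p _; rewrite mulrBl.
rewrite (le_trans (pairing_bound (wgt2B (u_wgt2 tT) (u_wgt2 t0T')) adk del0))//.
rewrite [e in leRHS]splitr lerD//; first by rewrite ler_pdivrMl.
rewrite -/c2 /del mulrAC ler_pdivrMr// ler_wpM2l ?lerDl//.
by rewrite ltW// divr_gt0.
Unshelve. all: by end_near. Qed.

Lemma quad_continuous rho C : quad_admissible rho C ->
  {within `[0, T], continuous (fun t => \int[mu2]_p (u t p ^+ 2 * rho p))}.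
Proof.
move=> adr; apply/subspace_continuousP => t0 t0T; apply/cvgrPdist_le => e e0.
have t0T' : t0 \in `[0, T] by [].
have C0 : 0 <= C by case: adr.
pose N := C * \int[mu2]_p dens (u t0) p.
have N0 : 0 <= N by rewrite mulr_ge0//; apply: Rintegral_ge0 => p _; exact: dens_ge0.
have N1 : 0 < N + 1 by rewrite ltr_wpDl.
(* [del] is fixed first, from the norm at the fixed time [t0]; the closeness of t to t0 is chosen
   afterwards, since it must beat the factor 1 + 1/del. *)
pose del := e / 2 / (N + 1).
have del0 : 0 < del by rewrite !divr_gt0.
have K0 : 0 < C * (1 + del^-1) + 1.
  by rewrite ltr_wpDl// mulr_ge0// addr_ge0// invr_ge0 ltW.
have ed0 : 0 < e / 2 / (C * (1 + del^-1) + 1) by rewrite !divr_gt0.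
have H := u_dens_near t0T' ed0.
near=> t.
have tT : t \in `[0, T] by near: t; rewrite near_withinE; exact: nearW.
have Ht : \int[mu2]_p dens (fun p => u t p - u t0 p) p <= e / 2 / (C * (1 + del^-1) + 1) by near: t.
rewrite distrC (le_trans (quad_diff (u_wgt2 tT) (u_wgt2 t0T') adr del0))//.
rewrite [e in leRHS]splitr lerD//.
  rewrite ler_pdivlMr// in Ht; rewrite (le_trans _ Ht)// mulrC ler_wpM2l ?lerDl//.
  by apply: Rintegral_ge0 => p _; exact: dens_ge0.
rewrite mulrAC -/N /del mulrC mulrAC ler_pdivrMr// ler_wpM2l ?lerDl//.
by rewrite ltW// divr_gt0.
Unshelve. all: by end_near. Qed.

End Flow.

(** * Growth of the kernels that the equation produces *)

Section TestKernels.
Context {R : realType}.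
Implicit Types (h W g : R -> R).

Lemma Cc_decay g : Cc g -> exists2 C, 0 <= C & forall y, g y ^+ 2 * (1 + y ^+ 2) <= C.
Proof.
move=> Cg; have [C C0 HC] := Cc_bounded Cg; have [_ [A HA]] := Cg.
have CA0 : 0 <= C ^+ 2 * (1 + A ^+ 2) by rewrite mulr_ge0 ?sqr_ge0// addr_ge0 ?sqr_ge0.
exists (C ^+ 2 * (1 + A ^+ 2)) => // y.
have [Ay|yA] := leP A `|y|; first by rewrite HA// expr0n/= mul0r.
rewrite ler_pM ?sqr_ge0 ?addr_ge0 ?sqr_ge0//.
  by rewrite -real_normK ?num_real// lerXn2r ?nnegrE// ltW.
have A0 := le_trans (normr_ge0 y) (ltW yA).
by rewrite lerD2l -(real_normK (num_real y)) lerXn2r ?nnegrE ?(ltW yA).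
Qed.

Lemma sq_linear_growth (a C x : R) : 0 <= C -> `|a| <= C * (1 + `|x|) ->
  a ^+ 2 <= 2 * C ^+ 2 * (1 + x ^+ 2).
Proof.
move=> C0 H; rewrite -(real_normK (num_real a)) -(real_normK (num_real x)).
apply: (@le_trans _ _ ((C * (1 + `|x|)) ^+ 2)); first by rewrite lerXn2r ?nnegrE// mulr_ge0// addr_ge0.
rewrite exprMn -subr_ge0.
have -> : 2 * C ^+ 2 * (1 + `|x| ^+ 2) - C ^+ 2 * (1 + `|x|) ^+ 2 = C ^+ 2 * (1 - `|x|) ^+ 2 by ring.
by rewrite mulr_ge0 ?sqr_ge0.
Qed.

(** The decay of g pays for the factor 1 + y^2, and the square of a linearly growing h costs another
    1 + x^2; the resulting (1 + x^2)^2 is at most [bracket p ^+ 2]. *)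
Lemma admissible_tensor h g (C D : R) : continuous h -> continuous g -> 0 <= C -> 0 <= D ->
  (forall x, `|h x| <= C * (1 + `|x|)) -> (forall y, g y ^+ 2 * (1 + y ^+ 2) <= D) ->
  admissible (fun p : plane R => h p.1 * g p.2) (2 * C ^+ 2 * D).
Proof.
move=> ch cg C0 D0 Hh Hg; split.
- by apply: measurable_funM; [exact: measurable_fun1|exact: measurable_fun2].
- by rewrite !mulr_ge0// sqr_ge0.
move=> p; have [_ b1 _] := bracket_ge p; have x0 := ltW (oneDsq_gt0 p.1).
apply: (@le_trans _ _ (2 * C ^+ 2 * (1 + p.1 ^+ 2) * D * (1 + p.1 ^+ 2))).
  have -> : (h p.1 * g p.2) ^+ 2 * ((1 + p.1 ^+ 2) * (1 + p.2 ^+ 2)) =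
    h p.1 ^+ 2 * (g p.2 ^+ 2 * (1 + p.2 ^+ 2)) * (1 + p.1 ^+ 2) by ring.
  rewrite ler_wpM2r// ler_pM ?sqr_ge0//.
    by rewrite mulr_ge0 ?sqr_ge0// addr_ge0 ?sqr_ge0.
  exact: sq_linear_growth.
have -> : 2 * C ^+ 2 * (1 + p.1 ^+ 2) * D * (1 + p.1 ^+ 2) =
  2 * C ^+ 2 * D * (1 + p.1 ^+ 2) ^+ 2 by ring.
rewrite ler_wpM2l ?mulr_ge0 ?sqr_ge0// lerXn2r ?nnegrE//.
exact: le_trans b1.
Qed.

Lemma admissibleD k1 k2 (C1 C2 : R) : admissible k1 C1 -> admissible k2 C2 ->
  admissible (fun p : plane R => k1 p + k2 p) (2 * C1 + 2 * C2).
Proof.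
move=> [m1 c1 H1] [m2 c2 H2]; split; first exact: measurable_funD.
  by rewrite addr_ge0// mulr_ge0.
move=> p; set c := (1 + p.1 ^+ 2) * (1 + p.2 ^+ 2).
have c0 : 0 <= c by rewrite mulr_ge0// ltW// oneDsq_gt0.
apply: (@le_trans _ _ ((2 * k1 p ^+ 2 + 2 * k2 p ^+ 2) * c)).
  rewrite ler_wpM2r// -subr_ge0.
  have -> : 2 * k1 p ^+ 2 + 2 * k2 p ^+ 2 - (k1 p + k2 p) ^+ 2 = (k1 p - k2 p) ^+ 2 by ring.
  exact: sqr_ge0.
have := lerD (H1 p) (H2 p); rewrite -/c -!mulrDl => h.
have -> : (2 * k1 p ^+ 2 + 2 * k2 p ^+ 2) * c = 2 * ((k1 p ^+ 2 + k2 p ^+ 2) * c) by ring.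
have -> : (2 * C1 + 2 * C2) * bracket p ^+ 2 = 2 * ((C1 + C2) * bracket p ^+ 2) by ring.
by rewrite ler_wpM2l.
Qed.

(** Both 1 + x^2 and 1 + y^2 are below the bracket. This covers functions of y alone, such as
    cos(eta y), which do not decay in either variable. *)
Lemma admissible_bounded (k : plane R -> R) (C : R) : measurable_fun setT k -> 0 <= C ->
  (forall p, `|k p| <= C) -> admissible k (C ^+ 2).
Proof.
move=> mk C0 H; split => //; first exact: sqr_ge0.
move=> p; have [_ b1 b2] := bracket_ge p.
have [x0 y0] := (ltW (oneDsq_gt0 p.1), ltW (oneDsq_gt0 p.2)).
rewrite ler_pM ?sqr_ge0 ?mulr_ge0//.
  by rewrite -(real_normK (num_real (k p))) lerXn2r ?nnegrE.
by rewrite expr2 ler_pM.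
Qed.

Lemma quad_admissible_tensor h g (C D : R) : continuous h -> continuous g ->
  0 <= C -> 0 <= D -> (forall x, `|h x| <= C * (1 + `|x|)) -> (forall y, `|g y| <= D) ->
  quad_admissible (fun p : plane R => h p.1 * g p.2) (2 * C * D).
Proof.
move=> ch cg C0 D0 Hh Hg; split.
- by apply: measurable_funM; [exact: measurable_fun1|exact: measurable_fun2].
- by rewrite !mulr_ge0.
move=> p; have [b1 b2 _] := bracket_ge p.
have bb : bracket p <= bracket p ^+ 2 by rewrite expr2 ler_peMr// (le_trans _ b1).
have hx : 1 + `|p.1| <= 2 * bracket p ^+ 2.
  have s := sqr_ge0 (1 - `|p.1|); have e := real_normK (num_real p.1).
  by rewrite -e in b2; have : (1 - `|p.1|) ^+ 2 = 1 - 2 * `|p.1| + `|p.1| ^+ 2 by [ring]; lra.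
rewrite normrM (le_trans (ler_pM _ _ (Hh p.1) (Hg p.2)))//.
have -> : 2 * C * D * bracket p ^+ 2 = C * (2 * bracket p ^+ 2) * D by ring.
by rewrite ler_wpM2r// ler_wpM2l.
Qed.

(* The adjoint of the linear part of the equation applied to W(x) g(y). *)
Definition kern W g (p : plane R) : R :=
  Hil (derive1 (derive1 W)) p.1 * (pi^-1 * g p.2) + derive1 W p.1 * derive1 (derive1 g) p.2.

Lemma kern_admissible W g (C D1 D2 : R) : Cc W -> Cc g -> 0 <= C -> 0 <= D1 -> 0 <= D2 ->
  (forall x, `|derive1 W x| <= C * (1 + `|x|)) ->
  (forall x, `|Hil (derive1 (derive1 W)) x| <= C * (1 + `|x|)) ->
  (forall y, (pi^-1 * g y) ^+ 2 * (1 + y ^+ 2) <= D1) ->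
  (forall y, derive1 (derive1 g) y ^+ 2 * (1 + y ^+ 2) <= D2) ->
  admissible (kern W g) (2 * (2 * C ^+ 2 * D1) + 2 * (2 * C ^+ 2 * D2)).
Proof.
move=> CW Cg C0 D10 D20 HW HH Hg1 Hg2; apply: admissibleD.
  apply: (admissible_tensor (h := Hil (derive1 (derive1 W))) (g := fun y => pi^-1 * g y)) => //.
    have [A [L P]] := Cc_pvdata (Cc_derive1 (Cc_derive1 CW)); exact: (Hil_continuous P).
  by move=> y; apply: cvgM; [exact: cvg_cst|exact: (Cc_continuous Cg)].
by apply: admissible_tensor => //; apply: Cc_continuous; do ?apply: Cc_derive1.
Qed.

(** A crude bound, but it has exactly the growth that [admissible_tensor] tolerates, and it survives
    the dilations x/n uniformly in n. *)
Lemma Hil_growth (f : R -> R) : Cc f -> exists2 C, 0 <= C & forall x, `|Hil f x| <= C * (1 + `|x|).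
Proof.
move=> Cf; have [A [L P]] := Cc_pvdata Cf; have [A0 L0] := (pv_A P, pv_L P).
exists (2 * L * (1 + A)); first by rewrite !mulr_ge0// addr_ge0.
move=> x; rewrite (le_trans (Hil_bound x P))//.
have -> : 2 * L * (1 + A) * (1 + `|x|) = 2 * L * ((1 + A) * (1 + `|x|)) by ring.
rewrite ler_wpM2l ?mulr_ge0//.
rewrite -subr_ge0.
have -> : (1 + A) * (1 + `|x|) - (`|x| + A) = 1 + A * `|x| by ring.
by rewrite addr_ge0// mulr_ge0.
Qed.

End TestKernels.

(** * Testing the equation against products *)

Section Identity.
Context {R : realType}.
Notation mu := (@lebesgue_measure R).
Notation mu2 := ((@lebesgue_measure R) \x (@lebesgue_measure R))%E.
Variables (T : R) (u : R -> plane R -> R).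
Hypothesis T_gt0 : 0 < T.
Hypothesis u_cont : continuous_in_Z 4 2 T u.
Hypothesis u_sol : distributional_solution T u.

(** [rate] is the time derivative of [amp], in the integrated sense of [amp_increment]. *)
Definition amp (W g : R -> R) (t : R) := \int[mu2]_p (u t p * (W p.1 * g p.2)).
Definition rate (W g : R -> R) (t : R) := \int[mu2]_p (u t p * kern W g p) +
  2^-1 * \int[mu2]_p (u t p ^+ 2 * (derive1 W p.1 * g p.2)).

Lemma Cc_linear_growth (f : R -> R) : Cc f -> exists2 C, 0 <= C & forall x, `|f x| <= C * (1 + `|x|).
Proof.
move=> /Cc_bounded[C C0 HC]; exists C; first exact: ltW.
by move=> x; rewrite (le_trans (HC x))// ler_peMr ?(ltW C0)// lerDl.
Qed.

Lemma amp_admissible (W g : R -> R) : Cc W -> Cc g ->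
  exists C, admissible (fun p : plane R => W p.1 * g p.2) C.
Proof.
move=> CW Cg; have [C C0 HC] := Cc_linear_growth CW; have [D D0 HD] := Cc_decay Cg.
exists (2 * C ^+ 2 * D).
by apply: admissible_tensor => //; exact: Cc_continuous.
Qed.

Lemma pig_Cc (g : R -> R) : Cc g -> Cc (fun y => pi^-1 * g y).
Proof.
move=> Cg; have := CcM Cg (Cinf_cst pi^-1); congr Cc; apply/funext => y.
exact: mulrC.
Qed.

Lemma rate_admissible (W g : R -> R) : Cc W -> Cc g ->
  (exists C, admissible (kern W g) C) /\
  (exists C, quad_admissible (fun p : plane R => derive1 W p.1 * g p.2) C).
Proof.
move=> CW Cg; have CW1 := Cc_derive1 CW.
have [C1 C10 HC1] := Cc_linear_growth CW1.
have [C2 C20 HC2] := Hil_growth (Cc_derive1 CW1).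
have [D1 D10 HD1] := Cc_decay (pig_Cc Cg).
have [D2 D20 HD2] := Cc_decay (Cc_derive1 (Cc_derive1 Cg)).
have [D3 D30 HD3] := Cc_bounded Cg.
split.
  eexists; apply: (@kern_admissible _ W g (C1 + C2) D1 D2) => //.
  - exact: addr_ge0.
  - by move=> x; rewrite (le_trans (HC1 x))// ler_wpM2r ?addr_ge0// lerDl.
  - by move=> x; rewrite (le_trans (HC2 x))// ler_wpM2r ?addr_ge0// lerDr.
eexists; apply: (quad_admissible_tensor (C := C1) (D := D3)) => //; last exact: ltW.
  exact: Cc_continuous.
exact: Cc_continuous.
Qed.

(** On a product each derivative falls on a single factor, so the space integral splits into th'
    times [amp] plus th times [rate]; admissibility makes each piece integrable, which the splitting
    needs. *)
Lemma tested_equation (W g th : R -> R) : Cc W -> Cc g -> time_test T th ->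
  \int[mu]_(t in `]0, T[) (derive1 th t * amp W g t + th t * rate W g t) = 0.
Proof.
move=> CW Cg [Cth [c [d [c0 dT thcd]]]].
have [CWi Cgi] := (CW.1, Cg.1).
rewrite -[RHS](u_sol (test_function_tensor c0 dT CW Cg Cth thcd)).
apply: eq_Rintegral => t; rewrite inE/= in_itv/= => /andP[t0 tT].
have tT' : t \in `[0, T] by rewrite in_itv/= !ltW.
have wt := u_wgt2 u_cont tT'.
have [C1 ad1] := amp_admissible CW Cg.
have [[C2 ad2] [C3 ad3]] := rate_admissible CW Cg.
have I1 := pairing_integrable wt ad1.
have I2 := pairing_integrable wt ad2.
have I3 := quad_integrable wt ad3.
have [A [L P]] := Cc_pvdata (Cc_derive1 (Cc_derive1 CW)).
rewrite /amp /rate mulrDr addrA mulrA -(Rintegral_lin2 _ _ I1 I2).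
have I12 : mu2.-integrable setT (EFin \o (fun p => derive1 th t * (u t p * (W p.1 * g p.2)) +
    th t * (u t p * kern W g p))).
  exact: (integrableD measurableT (integrableZl measurableT _ I1) (integrableZl measurableT _ I2)).
rewrite -RintegralZl// -RintegralD//; last exact: (integrableZl measurableT _ I3).
apply: eq_Rintegral => p _.
have C1W := Cinf_derive1 CWi; have C1g := Cinf_derive1 Cgi.
rewrite (d_t_tensor CWi Cgi Cth) (d_x_tensor CWi Cgi Cth) (d_x_tensor C1W Cgi Cth).
rewrite (d_y_tensor CWi Cgi Cth) (d_y_tensor CWi C1g Cth) (d_x_tensor CWi (Cinf_derive1 C1g) Cth).
have -> : (fun q : R * R => tensor (derive1 (derive1 W)) g th (q, t)) =
    (fun q => (th t * g q.2) * derive1 (derive1 W) q.1).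
  by apply/funext => q; rewrite /tensor /=; ring.
rewrite (hilbert_x_tensor (fun y => th t * g y) _ P) /tensor /kern /=; ring.
Qed.

Lemma amp_increment (W g : R -> R) s1 s2 : Cc W -> Cc g -> 0 <= s1 -> s1 < s2 -> s2 <= T ->
  amp W g s2 - amp W g s1 = \int[mu]_(t in `]s1, s2[) rate W g t.
Proof.
move=> CW Cg s10 s12 s2T.
have [C1 ad1] := amp_admissible CW Cg.
have [[C2 ad2] [C3 ad3]] := rate_admissible CW Cg.
apply: (weak_derivative T_gt0) => //.
- exact: (pairing_continuous u_cont ad1).
- move=> t; apply: cvgD; first exact: (pairing_continuous u_cont ad2).
  by apply: cvgM; [exact: cvg_cst|exact: (quad_continuous u_cont ad3)].
- by move=> th tth; exact: tested_equation.
Qed.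

Definition mass (g : R -> R) (t : R) := \int[mu2]_p (u t p * g p.2).

Lemma one_tensor_admissible (g : R -> R) : Cc g ->
  exists C, admissible (fun p : plane R => g p.2) C.
Proof.
move=> Cg; have [D D0 HD] := Cc_bounded Cg; exists (D ^+ 2).
apply: admissible_bounded => //; last exact: ltW.
by apply: measurable_fun2; exact: Cc_continuous.
Qed.

(* Since W_n'' is seen only through Hil W_n'' -> h0, only mass(g) survives. *)
Lemma amp_limit (W : nat -> R -> R) (g : R -> R) (h0 C s1 s2 : R) :
  (forall n, Cc (W n)) -> Cc g -> 0 <= C ->
  (forall n x, `|derive1 (W n) x| <= C * (1 + `|x|)) ->
  (forall x, derive1 (W n) x @[n --> \oo] --> 0) ->
  (forall n x, `|Hil (derive1 (derive1 (W n))) x| <= C * (1 + `|x|)) ->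
  (forall x, Hil (derive1 (derive1 (W n))) x @[n --> \oo] --> h0) ->
  0 <= s1 -> s1 < s2 -> s2 <= T ->
  amp (W n) g s2 - amp (W n) g s1 @[n --> \oo] -->
    \int[mu]_(t in `]s1, s2[) (h0 * pi^-1 * mass g t).
Proof.
move=> CW Cg C0 W1 W1l H2 H2l s10 s12 s2T.
under eq_fun do rewrite amp_increment//.
have [D1 D10 HD1] := Cc_decay (pig_Cc Cg).
have [D2 D20 HD2] := Cc_decay (Cc_derive1 (Cc_derive1 Cg)).
have [D3 D30 HD3] := Cc_bounded Cg.
pose K1 := 2 * (2 * C ^+ 2 * D1) + 2 * (2 * C ^+ 2 * D2).
have ad1 n : admissible (kern (W n) g) K1 by exact: kern_admissible.
pose K2 := 2 * C * D3.
have ad2 n : quad_admissible (fun p : plane R => derive1 (W n) p.1 * g p.2) K2.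
  apply: quad_admissible_tensor => //; last exact: ltW.
    by apply: Cc_continuous; exact: Cc_derive1.
  exact: Cc_continuous.
(* The extreme density, rho = bracket^2, turns [N] into a quadratic pairing; hence [N] is continuous
   in time and can enter the dominating function. *)
have adb : quad_admissible (fun p : plane R => bracket p ^+ 2) 1.
  split => //; first by apply: measurable_funX; exact: measurable_bracket.
  by move=> p; rewrite mul1r ger0_norm// sqr_ge0.
pose c2 := \int[mu2]_p @cauchy2 R p.
pose N t := \int[mu2]_p dens (u t) p.
have sub : `]s1, s2[%classic `<=` (`[0, T]%classic : set R).
  by move=> t /=; rewrite !in_itv/= => /andP[h1 h2]; apply/andP; split; lra.
have iC (f : R -> R) : {within `[0, T], continuous f} -> mu.-integrable `]s1, s2[ (EFin \o f).
  move=> cf; apply: (@integrableS _ _ _ mu `[0, T]) => //.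
  by apply: continuous_compact_integrable => //; exact: segment_compact.
have cN : {within `[0, T], continuous N}.
  have -> : N = (fun t => \int[mu2]_p (u t p ^+ 2 * bracket p ^+ 2)).
    by apply/funext => t; apply: eq_Rintegral => p _; rewrite mulrC.
  exact: (quad_continuous u_cont adb).
have crate n : {within `[0, T], continuous (rate (W n) g)}.
  move=> t; apply: cvgD; first exact: (pairing_continuous u_cont (ad1 n)).
  by apply: cvgM; [exact: cvg_cst|exact: (quad_continuous u_cont (ad2 n))].
(* The dominating function is the sum of [pairing_bound] with e = 1 and of [quad_bound]; the factor
   1/2 of the nonlinear term is bounded by 1. The constants K1 and K2 do not depend on n. *)
apply: (@Rdominated_convergence _ (measurableTypeR R) R mu _
  (fun n t => rate (W n) g t) _ (fun t => (N t + K1 * c2) + K2 * N t)) => //.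
- by move=> n; apply/measurable_EFinP; exact: (measurable_int _ (iC _ (crate n))).
- move=> t /sub tT; have wt := u_wgt2 u_cont tT.
  rewrite -[X in _ --> X]addr0; apply: cvgD.
    have -> : h0 * pi^-1 * mass g t = \int[mu2]_p (u t p * (h0 * (pi^-1 * g p.2))).
      have [C' adg] := one_tensor_admissible Cg.
      rewrite /mass -RintegralZl//; last exact: (pairing_integrable wt adg).
      by apply: eq_Rintegral => p _; ring.
    apply: (pairing_cvg wt ad1) => p; rewrite /kern -[X in _ --> X]addr0; apply: cvgD.
      by apply: cvgM; [exact: H2l|exact: cvg_cst].
    rewrite -(mul0r (derive1 (derive1 g) p.2)).
    by apply: cvgM; [exact: W1l|exact: cvg_cst].
  rewrite -(mulr0 2^-1); apply: cvgMr.
  have -> : 0 = \int[mu2]_p (u t p ^+ 2 * 0).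
    by rewrite /Rintegral integral0_eq// => p _; rewrite mulr0.
  apply: (quad_cvg wt ad2) => p; rewrite -(mul0r (g p.2)).
  by apply: cvgM; [exact: W1l|exact: cvg_cst].
- apply: (iC (fun t => (N t + K1 * c2) + K2 * N t)) => t; apply: cvgD.
    by apply: cvgD; [exact: cN|exact: cvg_cst].
  by apply: cvgM; [exact: cvg_cst|exact: cN].
- move=> n t /sub tT; have wt := u_wgt2 u_cont tT.
  rewrite (le_trans (ler_normD _ _))// lerD//.
    have := pairing_bound wt (ad1 n) ltr01.
    by rewrite invr1 !mul1r.
  have q := quad_bound wt (ad2 n); rewrite normrM ger0_norm ?invr_ge0//.
  rewrite (le_trans _ q)// ler_piMl// invf_le1// ler1n//.
Qed.

End Identity.

(** * Dilated test functions *)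

Section Dilations.
Context {R : realType}.
Implicit Types (f g : R -> R).

Definition dil (c a : R) f : R -> R := fun x => c * f (a * x).

Lemma Cc_dil c a f : a != 0 -> Cc f -> Cc (dil c a f).
Proof.
move=> a0 Cf; have := CcM (Cc_scale a0 Cf) (Cinf_cst c); congr Cc.
by apply/funext => x; exact: mulrC.
Qed.

Lemma derive1_dil c a f : Cinf f -> derive1 (dil c a f) = dil (c * a) a (derive1 f).
Proof.
move=> Cf; apply/funext => x; rewrite /dil derive1cZ.
  by rewrite derive1_scale// mulrA.
by have := Cinf_lincomb a 0 Cf; congr Cinf; apply/funext => y; rewrite addr0.
Qed.

Lemma Hil_dil c a f x : 0 < a -> Cc f -> Hil (dil c a f) x = c * Hil f (a * x).
Proof.
move=> a0 Cf; have [A [L P]] := Cc_pvdata Cf.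
have [A' [L' P']] := Cc_pvdata (Cc_scale (lt0r_neq0 a0) Cf).
by rewrite /dil (Hil_cZ _ _ P') (Hil_scale _ a0 P P').
Qed.

Lemma invn_cvg0 : (n.+1%:R : R)^-1 @[n --> \oo] --> 0.
Proof. exact: cvg_harmonic. Qed.

Lemma invn_gt0 n : 0 < (n.+1%:R : R)^-1.
Proof. by rewrite invr_gt0 ltr0n. Qed.

Lemma invn_le1 n : (n.+1%:R : R)^-1 <= 1.
Proof. by rewrite invf_le1 ?ltr0n// ler1n. Qed.

Lemma invn_scale_cvg f (x : R) : continuous f ->
  f (n.+1%:R^-1 * x) @[n --> \oo] --> f 0.
Proof.
move=> cf; apply: (@cvg_comp _ _ _ (fun n => n.+1%:R^-1 * x) f); last exact: cf.
have H : n.+1%:R^-1 * x @[n --> \oo] --> 0 * x by apply: cvgM; [exact: invn_cvg0|exact: cvg_cst].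
by rewrite mul0r in H.
Qed.

Lemma invn_scale_growth f C n (x : R) : 0 <= C ->
  (forall x, `|f x| <= C * (1 + `|x|)) -> `|f (n.+1%:R^-1 * x)| <= C * (1 + `|x|).
Proof.
move=> C0 H; rewrite (le_trans (H _))// ler_wpM2l// lerD2l normrM.
rewrite gtr0_norm ?invn_gt0// ler_piMl// invn_le1//.
Qed.

(* The factor n^2 makes W'' of size 1 at scale n, so that Hil W'' tends to the
   constant Hil w0'' 0, while W' = O(1 + |x|) tends to 0 pointwise. *)
Definition dipole n : R -> R := dil (n.+1%:R ^+ 2) n.+1%:R^-1 w0.

Lemma dipole_Cc n : Cc (dipole n).
Proof. by apply: Cc_dil; [rewrite lt0r_neq0// invn_gt0|exact: Cc_smooth_bump]. Qed.

Lemma dipole_derive n : derive1 (dipole n) = dil n.+1%:R n.+1%:R^-1 (derive1 w0).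
Proof.
rewrite derive1_dil; last exact: Cinf_smooth_bump.
by congr dil; rewrite expr2 mulfK// pnatr_eq0.
Qed.

Lemma dipole_derive2 n : derive1 (derive1 (dipole n)) = dil 1 n.+1%:R^-1 (derive1 (derive1 w0)).
Proof.
rewrite dipole_derive derive1_dil; last exact/Cinf_derive1/Cinf_smooth_bump.
by congr dil; rewrite divff// pnatr_eq0.
Qed.

(** The derivative of [dipole n] has a factor n + 1, but it vanishes for x < n + 1, so where it is
    nonzero that factor is at most |x|. *)
Lemma dipole_derive_growth : exists2 C, 0 <= C & forall n x, `|derive1 (dipole n) x| <= C * (1 + `|x|).
Proof.
have [C C0 HC] := Cc_bounded (Cc_derive1 (Cc_smooth_bump 1 2 : Cc (@w0 R))).
exists C; first exact: ltW.
move=> n x; rewrite dipole_derive /dil.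
have n0 : 0 < n.+1%:R :> R by rewrite ltr0n.
have [x1|x1] := ltP (n.+1%:R^-1 * x) 1.
  rewrite (w0_derive_out _).1; last by left.
  by rewrite mulr0 normr0 mulr_ge0 ?addr_ge0// ltW.
rewrite normrM mulrC ler_pM// gtr0_norm//.
move: x1; rewrite ler_pdivlMl// mulr1 => x1.
by rewrite (le_trans x1)// (le_trans (ler_norm x))// lerDr.
Qed.

Lemma dipole_derive_cvg0 (x : R) : derive1 (dipole n) x @[n --> \oo] --> 0.
Proof.
apply: cvg_near_cst; near=> n; rewrite dipole_derive /dil (w0_derive_out _).1 ?mulr0//.
left; rewrite ltr_pdivrMl ?ltr0n// mulr1.
have : x < n%:R by near: n; exact: nbhs_infty_gtr.
by move=> /lt_le_trans; apply; rewrite ler_nat.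
Unshelve. all: by end_near. Qed.

Lemma dipole_Hil n x : Hil (derive1 (derive1 (dipole n))) x =
  Hil (derive1 (derive1 w0)) (n.+1%:R^-1 * x).
Proof.
rewrite dipole_derive2 Hil_dil ?invn_gt0 ?mul1r//.
by do 2 apply: Cc_derive1; exact: Cc_smooth_bump.
Qed.

(** It tends pointwise to the constant b(0) > 0, where b is the bump on ]-1, 1[. Since b is not
    normalised, b(0) is carried along and divided out at the end. *)
Definition plateau n : R -> R := dil 1 n.+1%:R^-1 (smooth_bump (- 1) 1).

Lemma plateau_Cc n : Cc (plateau n).
Proof. by apply: Cc_dil; [rewrite lt0r_neq0// invn_gt0|exact: Cc_smooth_bump]. Qed.

Lemma plateau_derive n : derive1 (plateau n) =
  dil n.+1%:R^-1 n.+1%:R^-1 (derive1 (smooth_bump (- 1) 1)).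
Proof. by rewrite derive1_dil ?mul1r//; exact: Cinf_smooth_bump. Qed.

Lemma plateau_derive2 n : derive1 (derive1 (plateau n)) =
  dil (n.+1%:R^-1 * n.+1%:R^-1) n.+1%:R^-1 (derive1 (derive1 (smooth_bump (- 1) 1))).
Proof. by rewrite plateau_derive derive1_dil//; exact/Cinf_derive1/Cinf_smooth_bump. Qed.

Lemma dil_growth (c a C : R) f x : 0 <= c -> c <= 1 -> `|f (a * x)| <= C * (1 + `|x|) ->
  `|dil c a f x| <= C * (1 + `|x|).
Proof.
move=> c0 c1 H; apply: le_trans H; rewrite /dil normrM ger0_norm// ler_piMl//.
Qed.

End Dilations.

(** * Decay of the dipole pairings under the weight 5/2 *)

Section WeightedDecay.
Context {R : realType}.
Notation mu := (@lebesgue_measure R).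
Notation mu2 := ((@lebesgue_measure R) \x (@lebesgue_measure R))%E.

(** The product is (l^(5/2) a) (K l^(-1/2)): the first square matches the weight 5/2 at x >= l, and
    the second, K^2 / l, integrates to a constant over a slab of length l. Completing the square
    gives 1/4 in the last term, relaxed to 1. *)
Lemma amgm_scale (a K l d : R) : 0 < l -> 0 < d ->
  l ^+ 2 * (a * K) <= d^-1 * (l ^+ 5 * a ^+ 2) + d * (K ^+ 2 * l^-1).
Proof.
move=> l0 d0; have h : 0 <= d^-1 * l^-1 * (l ^+ 3 * a - 2^-1 * d * K) ^+ 2.
  by rewrite mulr_ge0 ?sqr_ge0// mulr_ge0// invr_ge0 ltW.
have e : d^-1 * l^-1 * (l ^+ 3 * a - 2^-1 * d * K) ^+ 2 =
   d^-1 * (l ^+ 5 * a ^+ 2) + 4^-1 * (d * (K ^+ 2 * l^-1)) - l ^+ 2 * (a * K).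
  by field; rewrite !gt_eqF.
have h2 : 0 <= d * (K ^+ 2 * l^-1) by rewrite mulr_ge0 ?(ltW d0)// mulr_ge0 ?sqr_ge0// invr_ge0 ltW.
rewrite e in h; lra.
Qed.

Definition slab (n : nat) (A : R) : set (plane R) :=
  (`[n.+1%:R, 2 * n.+1%:R]%classic : set (measurableTypeR R)) `*`
  (`[- A, A]%classic : set (measurableTypeR R)).

Lemma measurable_slab n A : measurable (slab n A).
Proof. by apply: measurableX; exact: measurable_itv. Qed.

Lemma slab_measure n A : 0 <= A -> (mu2 (slab n A) = (n.+1%:R * (2 * A))%:E)%E.
Proof.
move=> A0; have n0 : 0 < n.+1%:R :> R by rewrite ltr0n.
have m1 : mu `[n.+1%:R, 2 * n.+1%:R] = (n.+1%:R)%:E.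
  by rewrite lebesgue_measure_itv/= lte_fin ifT -?EFinB; [congr EFin; ring|lra].
have m2 : mu `[- A, A] = (2 * A)%:E.
  rewrite lebesgue_measure_itv/= lte_fin; case: ifPn => [_|]; first by rewrite -EFinB; congr EFin; ring.
  by rewrite -leNgt => h; congr EFin; lra.
transitivity ((n.+1%:R)%:E * (2 * A)%:E)%E; last by rewrite EFinM.
by rewrite -m1 -m2; apply: product_measure1E; exact: measurable_itv.
Qed.

Lemma slab_integrable n A : 0 <= A -> mu2.-integrable setT (EFin \o \1_(slab n A)).
Proof.
move=> A0; apply/integrableP; split.
  by apply/measurable_EFinP; apply: measurable_indic; exact: measurable_slab.
under eq_integral do rewrite /= ger0_norm//.
rewrite integral_indic ?setIT//; last exact: measurable_slab.
have h : (mu2 (slab n A) < +oo)%E by rewrite slab_measure// ltry.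
exact: h.
Qed.

Lemma slab_integral n A : 0 <= A -> \int[mu2]_p \1_(slab n A) p = n.+1%:R * (2 * A).
Proof.
move=> A0; rewrite /Rintegral integral_indic ?setIT//; last exact: measurable_slab.
have h : fine (mu2 (slab n A)) = n.+1%:R * (2 * A) by rewrite slab_measure.
exact: h.
Qed.

Lemma powR52 (l b : R) : 0 <= l -> l ^+ 2 <= b -> l ^+ 5 <= b `^ (5 / 2).
Proof.
move=> l0 lb; have -> : l ^+ 5 = (l ^+ 2) `^ (5 / 2).
  rewrite -(powR_mulrn 2 l0) -powRrM -(powR_mulrn 5 l0); congr (_ `^ _).
  by rewrite mulrCA divff ?mulr1// pnatr_eq0.
by rewrite ge0_ler_powR ?nnegrE ?sqr_ge0 ?divr_ge0// (le_trans _ lb)// sqr_ge0.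
Qed.

(** For every d the pairing is at most 1/d times the tail over x >= n + 1 of the weighted norm, plus
    d times a constant independent of n. First d is taken small, then n large. *)
Lemma dipole_pairing_cvg0 (f : plane R -> R) (g : R -> R) : in_weighted (5 / 2) f -> Cc g ->
  \int[mu2]_p (f p * (dipole n p.1 * g p.2)) @[n --> \oo] --> 0.
Proof.
move=> [mf ff] Cg.
pose q (p : plane R) := bracket p `^ (5 / 2) * f p ^+ 2.
have q0 p : 0 <= q p by rewrite mulr_ge0 ?powR_ge0 ?sqr_ge0.
have mq : measurable_fun setT q.
  apply: measurable_funM; last exact: measurable_funX.
  by apply: (measurableT_comp (measurable_powR _)); exact: measurable_bracket.
have Iq : mu2.-integrable setT (EFin \o q).
  apply/integrableP; split; first by apply/measurable_EFinP; exact: mq.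
  by under eq_integral do rewrite /= ger0_norm//.
have [K1 K10 HK1] := Cc_bounded (Cc_smooth_bump 1 2 : Cc (@w0 R)).
have [K2 K20 HK2] := Cc_bounded Cg.
have [_ [A0 HA0]] := Cg; pose A := `|A0|.
have HA y : A <= `|y| -> g y = 0.
  by move=> h; apply: HA0; rewrite (le_trans _ h)// ler_norm.
pose K := K1 * K2.
have K_ge0 : 0 <= K by rewrite mulr_ge0// ltW.
(* Keeping this indicator in the bound turns the weighted norm into a tail; without it the bound
   would not tend to 0. *)
pose far n (p : plane R) : R := \1_(`[n.+1%:R, +oo[%classic : set (measurableTypeR R)) p.1.
have mfar n : measurable_fun setT (far n).
  have -> : far n = (\1_(`[n.+1%:R, +oo[%classic : set (measurableTypeR R)) : measurableTypeR R -> R) \o fst by [].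
  apply: measurableT_comp; last exact: measurable_fst.
  by apply: measurable_indic; exact: measurable_itv.
have far01 n p : 0 <= far n p <= 1.
  by rewrite /far indicE; case: (_ \in _); rewrite ?lexx ?ler01.
have qfar_le n p : `|q p * far n p| <= q p.
  have /andP[h1 h2] := far01 n p.
  by rewrite (ger0_norm (mulr_ge0 (q0 p) h1)); exact: (ler_piMr (q0 p) h2).
have Iqfar n : mu2.-integrable setT (EFin \o (fun p => q p * far n p)).
  apply: (dominated_Rintegrable _ _ Iq) => //; first exact: measurable_funM.
have tail : \int[mu2]_p (q p * far n p) @[n --> \oo] --> 0.
  have -> : 0 = \int[mu2]_p (q p * 0).
    by rewrite /Rintegral integral0_eq// => p _; rewrite mulr0.
  apply: (Rdominated_convergence _ _ _ Iq) => //; first by move=> n; exact: measurable_funM.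
  move=> p _; apply: cvg_near_cst; near=> n.
  rewrite /far indicE memNset ?mulr0//= in_itv/= andbT; apply/negP; rewrite -ltNge.
  have : p.1 < n%:R by near: n; exact: nbhs_infty_gtr.
  by move=> /lt_le_trans; apply; rewrite ler_nat.
have pt n p d : 0 < d -> `|f p * (dipole n p.1 * g p.2)| <=
    d^-1 * (q p * far n p) + (d * (K ^+ 2 * n.+1%:R^-1)) * \1_(slab n A) p.
  move=> d0; have n0 : 0 < n.+1%:R :> R by rewrite ltr0n.
  have r0 : 0 <= d^-1 * (q p * far n p) + (d * (K ^+ 2 * n.+1%:R^-1)) * \1_(slab n A) p.
    have /andP[h1 _] := far01 n p.
    apply: addr_ge0; apply: mulr_ge0 => //.
    - by rewrite invr_ge0 ltW.
    - exact: mulr_ge0 (q0 p) h1.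
    - by rewrite mulr_ge0 ?(ltW d0)// mulr_ge0 ?sqr_ge0// invr_ge0 ltW.
  have [yA|yA] := leP A `|p.2|; first by rewrite (HA _ yA) !mulr0 normr0.
  have [x1|x1] := leP (n.+1%:R^-1 * p.1) 1.
    by rewrite /dipole /dil /w0 smooth_bump_out ?x1// mulr0 mul0r mulr0 normr0.
  have [x2|x2] := leP 2 (n.+1%:R^-1 * p.1).
    by rewrite /dipole /dil /w0 smooth_bump_out ?x2 ?orbT// mulr0 mul0r mulr0 normr0.
  have x1' : n.+1%:R < p.1 by move: x1; rewrite ltr_pdivlMl// mulr1.
  have x2' : p.1 < 2 * n.+1%:R by move: x2; rewrite ltr_pdivrMl// mulrC.
  rewrite /far indicE mem_set/= ?in_itv/= ?(ltW x1')// mulr1.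
  rewrite indicE mem_set ?mulr1; last first.
    by split; rewrite /= in_itv/= ?(ltW x1') ?(ltW x2')//= -ler_norml ltW.
  have -> : `|f p * (dipole n p.1 * g p.2)| = n.+1%:R ^+ 2 * (`|f p| * (`|w0 (n.+1%:R^-1 * p.1)| * `|g p.2|)).
    rewrite /dipole /dil -mulrA mulrCA normrM (ger0_norm (sqr_ge0 _)).
    by rewrite (normrM (f p)) (normrM (w0 _)).
  apply: (@le_trans _ _ (n.+1%:R ^+ 2 * (`|f p| * K))).
    by rewrite ler_wpM2l ?sqr_ge0// ler_wpM2l// ler_pM.
  apply: (le_trans (amgm_scale _ _ n0 d0)); rewrite lerD2r ler_wpM2l ?invr_ge0 ?(ltW d0)//.
  rewrite real_normK ?num_real// ler_wpM2r ?sqr_ge0// powR52 ?(ltW n0)//.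
  have [_ b1 _] := bracket_ge p; apply: (le_trans _ b1).
  rewrite (@le_trans _ _ (p.1 ^+ 2)) ?lerDr//.
  by rewrite lerXn2r ?nnegrE ?(ltW n0) ?(ltW x1')// (le_trans (ltW n0) (ltW x1')).
have md n : measurable_fun setT (fun p : plane R => f p * (dipole n p.1 * g p.2)).
  apply: measurable_funM => //; apply: measurable_funM.
    by apply: measurable_fun1; exact: (Cc_continuous (dipole_Cc n)).
  by apply: measurable_fun2; exact: (Cc_continuous Cg).
have Idom n d : mu2.-integrable setT (EFin \o (fun p =>
    d^-1 * (q p * far n p) + (d * (K ^+ 2 * n.+1%:R^-1)) * \1_(slab n A) p)).
  exact: (integrableD measurableT (integrableZl measurableT _ (Iqfar n))
    (integrableZl measurableT _ (slab_integrable n (normr_ge0 A0)))).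
have bound n d : 0 < d -> `|\int[mu2]_p (f p * (dipole n p.1 * g p.2))| <=
    d^-1 * \int[mu2]_p (q p * far n p) + d * (K ^+ 2 * (2 * A)).
  move=> d0.
  have Id : mu2.-integrable setT (EFin \o (fun p => f p * (dipole n p.1 * g p.2))).
    by apply: (dominated_Rintegrable _ (md n) (Idom n d)) => // p _; exact: pt.
  rewrite (le_trans (le_normr_Rintegral measurableT Id))//.
  have -> : d * (K ^+ 2 * (2 * A)) = (d * (K ^+ 2 * n.+1%:R^-1)) * \int[mu2]_p \1_(slab n A) p.
    rewrite (slab_integral n (normr_ge0 A0)) -/A; field.
    by rewrite nat1r pnatr_eq0.
  rewrite -(Rintegral_lin2 _ _ (Iqfar n) (slab_integrable n (normr_ge0 A0))).
  apply: le_Rintegral => //; first exact: (integrable_norm Id).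
  by move=> p _; exact: pt.
apply/cvgrPdist_le => e e0.
pose M := K ^+ 2 * (2 * A) + 1.
have M0 : 0 < M by rewrite /M ltr_wpDl// mulr_ge0 ?sqr_ge0// mulr_ge0// normr_ge0.
pose d := e / 2 / M.
have d0 : 0 < d by rewrite !divr_gt0.
have de0 : 0 < d * (e / 2) by rewrite mulr_gt0// divr_gt0.
near=> n; rewrite sub0r normrN (le_trans (bound n d d0))//.
rewrite [e in leRHS]splitr lerD//.
  by rewrite ler_pdivrMl//; near: n; exact: (cvgr_le _ tail).
rewrite /d mulrAC ler_pdivrMr// ler_wpM2l ?lerDl//.
by rewrite ltW// divr_gt0.
Unshelve. all: by end_near. Qed.

End WeightedDecay.

(** * Conservation of the mass, and its vanishing *)

Section Conclusion.
Context {R : realType}.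
Notation mu := (@lebesgue_measure R).
Notation mu2 := ((@lebesgue_measure R) \x (@lebesgue_measure R))%E.
Variables (T : R) (u : R -> plane R -> R).
Hypothesis T_gt0 : 0 < T.
Hypothesis u_cont : continuous_in_Z 4 2 T u.
Hypothesis u_sol : distributional_solution T u.

Lemma plateau_pairing_cvg (g : R -> R) t : t \in `[0, T] -> Cc g ->
  amp u (plateau n) g t @[n --> \oo] --> smooth_bump (- 1) 1 0 * mass u g t.
Proof.
move=> tT Cg; have wt := u_wgt2 u_cont tT.
have Cb : Cc (smooth_bump (- 1) 1 : R -> R) by exact: Cc_smooth_bump.
have [C C0 HC] := Cc_linear_growth Cb; have [D D0 HD] := Cc_decay Cg.
have [E adE] := one_tensor_admissible Cg.
have -> : smooth_bump (- 1) 1 0 * mass u g t =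
    \int[mu2]_p (u t p * (smooth_bump (- 1) 1 0 * g p.2)).
  rewrite /mass -RintegralZl//; last exact: (pairing_integrable wt adE).
  by apply: eq_Rintegral => p _; ring.
apply: (pairing_cvg (C := 2 * C ^+ 2 * D) wt) => [n|p].
  apply: admissible_tensor => //; [exact: (Cc_continuous (plateau_Cc n))|exact: Cc_continuous|].
  by move=> x; apply: dil_growth => //; exact: invn_scale_growth.
apply: cvgM; last exact: cvg_cst.
rewrite /plateau /dil -[X in _ --> X]mul1r; apply: cvgMr.
exact: (invn_scale_cvg _ (Cc_continuous Cb)).
Qed.

(** For the plateaus W'' carries a factor of order n^(-2), so Hil W'' tends to 0 and [amp_limit]
    applies with h0 = 0. The increments of [amp] thus tend to 0, while they also tend to b(0) times
    the increment of [mass]. *)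
Lemma mass_constant (g : R -> R) s1 s2 : Cc g -> 0 <= s1 -> s1 < s2 -> s2 <= T ->
  mass u g s1 = mass u g s2.
Proof.
move=> Cg s10 s12 s2T.
have s1T : s1 \in `[0, T] by rewrite in_itv/=; apply/andP; split; lra.
have s2T' : s2 \in `[0, T] by rewrite in_itv/=; apply/andP; split; lra.
have Cb : Cc (smooth_bump (- 1) 1 : R -> R) by exact: Cc_smooth_bump.
have [C1 C10 HC1] := Cc_linear_growth (Cc_derive1 Cb).
have C2b := Cc_derive1 (Cc_derive1 Cb).
have [C2 C20 HC2] := Hil_growth C2b.
have H1 x : `|derive1 (smooth_bump (- 1) 1) x| <= (C1 + C2) * (1 + `|x|).
  by rewrite (le_trans (HC1 x))// ler_wpM2r ?addr_ge0// lerDl.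
have H2 x : `|Hil (derive1 (derive1 (smooth_bump (- 1) 1))) x| <= (C1 + C2) * (1 + `|x|).
  by rewrite (le_trans (HC2 x))// ler_wpM2r ?addr_ge0// lerDr.
have C12 : 0 <= C1 + C2 by rewrite addr_ge0.
have [A [L P]] := Cc_pvdata C2b.
have Hplat (n : nat) (x : R) : Hil (derive1 (derive1 (plateau n))) x =
    dil (n.+1%:R^-1 * n.+1%:R^-1) n.+1%:R^-1 (Hil (derive1 (derive1 (smooth_bump (- 1) 1)))) x.
  rewrite plateau_derive2; apply: Hil_dil => //; exact: invn_gt0.
have := @amp_limit R T u T_gt0 u_cont u_sol (@plateau R) g 0 (C1 + C2) s1 s2
  (@plateau_Cc R) Cg C12 _ _ _ _ s10 s12 s2T.
rewrite [X in _ -> _ -> _ -> _ -> _ --> X](_ : _ = 0); last first.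
  by rewrite /Rintegral integral0_eq// => t _; rewrite !mul0r.
move=> lim0; have {}lim0 : amp u (plateau n) g s2 - amp u (plateau n) g s1 @[n --> \oo] --> 0.
  apply: lim0.
  - move=> n x; rewrite plateau_derive; apply: dil_growth; [exact: ltW (invn_gt0 n)|exact: invn_le1|].
    exact: invn_scale_growth.
  - move=> x; under eq_fun do rewrite plateau_derive /dil.
    rewrite -(mul0r (derive1 (smooth_bump (- 1) 1) 0)); apply: cvgM; first exact: invn_cvg0.
    exact: (invn_scale_cvg _ (Cc_continuous (Cc_derive1 Cb))).
  - move=> n x; rewrite Hplat; apply: dil_growth.
    + by rewrite mulr_ge0 ?(ltW (invn_gt0 n)).
    + by rewrite mulr_ile1 ?(ltW (invn_gt0 n)) ?invn_le1.
    + exact: invn_scale_growth.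
  - move=> x; under eq_fun do rewrite Hplat /dil.
    rewrite -(mul0r (Hil (derive1 (derive1 (smooth_bump (- 1) 1))) 0)); apply: cvgM.
      by rewrite -(mul0r 0); apply: cvgM; exact: invn_cvg0.
    exact: (invn_scale_cvg _ (Hil_continuous P)).
pose b : R := smooth_bump (- 1) 1 0.
have b0 : 0 < b by apply: smooth_bump_gt0; rewrite ?ltrN10 ?ltr01.
have lim1 : amp u (plateau n) g s2 - amp u (plateau n) g s1 @[n --> \oo] -->
    b * mass u g s2 - b * mass u g s1.
  by apply: cvgB; exact: plateau_pairing_cvg.
have e : b * mass u g s2 - b * mass u g s1 = 0.
  exact: (cvg_unique (@Rhausdorff R) lim1 lim0).
apply/eqP; rewrite eq_sym -subr_eq0; apply/eqP; apply: (mulfI (lt0r_neq0 b0)).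
by rewrite mulr0 mulrBr.
Qed.

(** The dipole increment between t1 and t2 has two limits: 0, by decay at both times, and a nonzero
    multiple of the time integral of [mass]. *)
Lemma mass_eq0 (g : R -> R) t1 t2 t : Cc g -> 0 <= t1 -> t1 < t2 -> t2 <= T ->
  in_weighted (5 / 2) (u t1) -> in_weighted (5 / 2) (u t2) -> 0 <= t <= T ->
  mass u g t = 0.
Proof.
move=> Cg t10 t12 t2T w1 w2 /andP[t0 tT].
have mc s s' : 0 <= s <= T -> 0 <= s' <= T -> mass u g s = mass u g s'.
  move=> /andP[a1 a2] /andP[b1 b2]; have [ss|ss|->//] := ltgtP s s'.
    exact: mass_constant.
  by apply/esym; exact: mass_constant.
have [C1 C10 HC1] := @dipole_derive_growth R.
have Cw : Cc (derive1 (derive1 (@w0 R))).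
  by do 2 apply: Cc_derive1; exact: Cc_smooth_bump.
have [C2 C20 HC2] := Hil_growth Cw.
have [A [L P]] := Cc_pvdata Cw.
have C12 : 0 <= C1 + C2 by rewrite addr_ge0.
have lim := @amp_limit R T u T_gt0 u_cont u_sol (@dipole R) g
  (Hil (derive1 (derive1 w0)) 0) (C1 + C2) t1 t2 (@dipole_Cc R) Cg C12.
have G1 (n : nat) (x : R) : `|derive1 (dipole n) x| <= (C1 + C2) * (1 + `|x|).
  by rewrite (le_trans (HC1 n x))// ler_wpM2r ?addr_ge0// lerDl.
have G2 (n : nat) (x : R) : `|Hil (derive1 (derive1 (dipole n))) x| <= (C1 + C2) * (1 + `|x|).
  rewrite dipole_Hil; apply: invn_scale_growth => // y.
  by rewrite (le_trans (HC2 y))// ler_wpM2r ?addr_ge0// lerDr.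
have G3 (x : R) : Hil (derive1 (derive1 (dipole n))) x @[n --> \oo] --> Hil (derive1 (derive1 w0)) 0.
  under eq_fun do rewrite dipole_Hil.
  exact: (invn_scale_cvg _ (Hil_continuous P)).
have {}lim := lim G1 (@dipole_derive_cvg0 R) G2 G3 t10 t12 t2T.
have lim0 : amp u (dipole n) g t2 - amp u (dipole n) g t1 @[n --> \oo] --> 0 - 0.
  by apply: cvgB; exact: dipole_pairing_cvg0.
have : \int[mu]_(s in `]t1, t2[) (Hil (derive1 (derive1 w0)) 0 * pi^-1 * mass u g s) = 0 - 0.
  exact: (cvg_unique (@Rhausdorff R) lim lim0).
rewrite subr0.
(* By conservation the integrand may be evaluated at the given time t, even if t is outside ]t1,
   t2[. *)
have -> : \int[mu]_(s in `]t1, t2[) (Hil (derive1 (derive1 w0)) 0 * pi^-1 * mass u g s) =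
    \int[mu]_(s in `]t1, t2[) (Hil (derive1 (derive1 w0)) 0 * pi^-1 * mass u g t).
  apply: eq_Rintegral => s; rewrite inE/= in_itv/= => /andP[s1 s2]; congr (_ * _).
  by apply: mc; apply/andP; split; lra.
have m12 : fine (mu `]t1, t2[) = t2 - t1.
  by rewrite lebesgue_measure_itv/= lte_fin t12.
rewrite Rintegral_cst// m12 => /eqP.
have pi0 : (pi : R) != 0 by rewrite gt_eqF// pi_gt0.
rewrite !mulf_eq0 invr_eq0 (negbTE Hil_w0_neq0) (negbTE pi0) /= subr_eq0 (gt_eqF t12) orbF.
by move/eqP.
Qed.

(** Passage from compactly supported g to merely bounded k, such as cos and sin: k is cut off in y
    by the plateaus. The kernels stay uniformly bounded, which suffices for dominated convergence
    under the weight 2. *)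
Lemma pairing_y_eq0 (k : R -> R) (C t : R) : Cinf k -> 0 <= C -> (forall y, `|k y| <= C) ->
  t \in `[0, T] -> (forall g, Cc g -> mass u g t = 0) ->
  \int[mu2]_p (u t p * k p.2) = 0.
Proof.
move=> Ck C0 HC tT m0; have wt := u_wgt2 u_cont tT.
have Cb : Cc (smooth_bump (- 1) 1 : R -> R) by exact: Cc_smooth_bump.
have [B B0 HB] := Cc_bounded Cb.
have b0 : 0 < smooth_bump (- 1) 1 (0 : R) by apply: smooth_bump_gt0; rewrite ?ltrN10 ?ltr01.
have mk : measurable_fun setT (fun p : plane R => k p.2).
  by apply: measurable_fun2; exact: Cinf_continuous.
have adk : admissible (fun p : plane R => k p.2) (C ^+ 2) by apply: admissible_bounded.
have Cg n : Cc (fun y => plateau n y * k y) by apply: CcM => //; exact: plateau_Cc.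
have lim : \int[mu2]_p (u t p * (plateau n p.2 * k p.2)) @[n --> \oo] -->
    \int[mu2]_p (u t p * (smooth_bump (- 1) 1 0 * k p.2)).
  apply: (pairing_cvg (C := (B * C) ^+ 2) wt) => [n|p].
    apply: admissible_bounded; [exact: (measurable_fun2 (Cc_continuous (Cg n)))|
      by rewrite mulr_ge0// ltW|].
    by move=> p; rewrite normrM ler_pM// /plateau /dil mul1r.
  apply: cvgM; last exact: cvg_cst.
  rewrite /plateau /dil -[X in _ --> X]mul1r; apply: cvgMr.
  exact: (invn_scale_cvg _ (Cc_continuous Cb)).
have z : (fun n => \int[mu2]_p (u t p * (plateau n p.2 * k p.2))) = fun=> 0.
  by apply/funext => n; exact: (m0 _ (Cg n)).
rewrite z in lim.
have : \int[mu2]_p (u t p * (smooth_bump (- 1) 1 0 * k p.2)) = 0.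
  exact: (cvg_unique (@Rhausdorff R) lim (cvg_cst 0)).
have -> : \int[mu2]_p (u t p * (smooth_bump (- 1) 1 0 * k p.2)) =
    smooth_bump (- 1) 1 0 * \int[mu2]_p (u t p * k p.2).
  rewrite -RintegralZl//; last exact: (pairing_integrable wt adk).
  by apply: eq_Rintegral => p _; ring.
by move=> /eqP; rewrite mulf_eq0 (gt_eqF b0) => /eqP.
Qed.

End Conclusion.

Theorem theorem1p5 (R : realType) (T : R) (T_gt0 : 0 < T)
    (u : R -> R * R -> R) (phi : R * R -> R)
    (u_cont : continuous_in_Z 4 2 T u)
    (u_sol : distributional_solution T u)
    (u_init : {ae leb2, forall p, u 0 p = phi p})
    (t1 t2 : R) (t1_in : t1 \in `[0, T]) (t2_in : t2 \in `[0, T])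
    (t1_neq_t2 : t1 <> t2)
    (u_t1 : in_Z 5 (5 / 2) (u t1)) (u_t2 : in_Z 5 (5 / 2) (u t2)) :
  forall eta t : R, t \in `[0, T] -> fourier (u t) (0, eta) = 0.
Proof.
move=> eta t tT.
have m0 g : Cc g -> mass u g t = 0.
  move: t1_in t2_in (tT); rewrite !in_itv/= => /andP[a1 b1] /andP[a2 b2] tT' Cg.
  have [t12|t21|//] := ltgtP t1 t2.
    exact: (mass_eq0 T_gt0 u_cont u_sol Cg a1 t12 b2 u_t1.2 u_t2.2 tT').
  exact: (mass_eq0 T_gt0 u_cont u_sol Cg a2 t21 b1 u_t2.2 u_t1.2 tT').
have [Ccos Csin] := Cinf_cos_sin eta.
have c0 := pairing_y_eq0 u_cont Ccos ler01 (fun y => cos_max _) tT m0.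
have s0 := pairing_y_eq0 u_cont Csin ler01 (fun y => sin_max _) tT m0.
(* At frequency xi = 0 the phase depends on y alone, so the real and imaginary parts are pairings
   with functions of y. *)
have E (p : R * R) : p.1 * (0, eta).1 + p.2 * (0, eta).2 = eta * p.2 by rewrite /=; ring.
have -> : fourier (u t) (0, eta) = Complex (\int[leb2]_p (u t p * cos (eta * p.2)))
    (- \int[leb2]_p (u t p * sin (eta * p.2))).
  by rewrite /fourier; congr Complex; [|congr (- _)]; apply: eq_Rintegral => p _; rewrite E.
by rewrite c0 s0 oppr0.
Qed.
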